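(* Assume $\boldsymbol E_0,\boldsymbol H_0\in \boldsymbol L^2(\Omega)$, and let $(\boldsymbol E,\boldsymbol H,\boldsymbol P)$ be the solution of the Havriliak–Negami (H-N) model $$\epsilon_\infty\partial_t\boldsymbol E+\partial_t\boldsymbol P=\nabla\times\boldsymbol H,\qquad \partial_t\boldsymbol H=-\nabla\times\boldsymbol E,\qquad \boldsymbol P(\boldsymbol x,t)=\Delta\epsilon\int_0^t\omega_{\alpha,\beta}(t-s)\boldsymbol E(\boldsymbol x,s)\,ds,\qquad (\boldsymbol x,t)\in\Omega\times(0,T],$$ with initial conditions $\boldsymbol E(\boldsymbol x,0)=\boldsymbol E_0(\boldsymbol x)$, $\boldsymbol H(\boldsymbol x,0)=\boldsymbol H_0(\boldsymbol x)$, $\boldsymbol P(\boldsymbol x,0)=\boldsymbol 0$ for $\boldsymbol x\in\Omega$, and boundary condition $\boldsymbol n\times\boldsymbol E=\boldsymbol 0$ on $\partial\Omega\times(0,T)$. Define $$\mathbb E(t)=\epsilon_\infty\|\boldsymbol E(\cdot,t)\|^2+\|\boldsymbol H(\cdot,t)\|^2+\Delta\epsilon\int_0^t\omega_{\alpha,\beta}(t-s)\|\boldsymbol E(\cdot,s)\|^2\,ds .$$ Then $\mathbb E(t_1)\le\mathbb E(t_2)$ for all $t_1,t_2\in[0,T]$ with $t_1>t_2$.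
   Context: $\Omega$ is the spatial domain with unit normal $\boldsymbol n$ on $\partial\Omega$; $T>0$ is the final time; $\|\cdot\|$ is the $L^2(\Omega)$ norm. The parameters satisfy $0<\alpha,\beta\le 1$, $\epsilon_s>\epsilon_\infty\ge 1$, and $\Delta\epsilon:=\epsilon_s-\epsilon_\infty$. The kernel $\omega_{\alpha,\beta}$ is the inverse Laplace transform $\omega_{\alpha,\beta}(t)=\mathcal L^{-1}\big[(1+s^\alpha)^{-\beta}\big](t)$; explicitly, $\omega_{\alpha,\beta}(t)=t^{\alpha\beta-1}\,\mathcal E^{\beta}_{\alpha,\alpha\beta}(-t^\alpha)$ with the three-parameter Mittag-Leffler (Prabhakar) function $\mathcal E^\gamma_{\rho,\mu}(z)=\frac{1}{\Gamma(\gamma)}\sum_{k=0}^\infty\frac{\Gamma(k+\gamma)}{\Gamma(\rho k+\mu)}\frac{z^k}{k!}$. The weak form of the model is: find $\boldsymbol E\in H_0(\mathrm{curl};\Omega)$ and $\boldsymbol H,\boldsymbol P\in\boldsymbol L^2(\Omega)$ such that $\epsilon_\infty(\partial_t\boldsymbol E,\boldsymbol\phi)+(\partial_t\boldsymbol P,\boldsymbol\phi)-(\boldsymbol H,\nabla\times\boldsymbol\phi)=0$ for all $\boldsymbol\phi\in H_0(\mathrm{curl};\Omega)$; $(\partial_t\boldsymbol H,\boldsymbol\psi)+(\nabla\times\boldsymbol E,\boldsymbol\psi)=0$ for all $\boldsymbol\psi\in\boldsymbol L^2(\Omega)$; and $(\boldsymbol P,\boldsymbol\varphi)-\Delta\epsilon\int_0^t\omega_{\alpha,\beta}(t-s)(\boldsymbol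 E(\cdot,s),\boldsymbol\varphi)\,ds=0$ for all $\boldsymbol\varphi\in\boldsymbol L^2(\Omega)$. Here $(\cdot,\cdot)$ is the $L^2(\Omega)$ inner product and $H_0(\mathrm{curl};\Omega)$ is the space of $L^2$ fields with $L^2$ curl and vanishing tangential trace $\boldsymbol n\times\boldsymbol v=\boldsymbol 0$ on $\partial\Omega$. *)

(* Defs.v *)
From HB Require Import structures.
From mathcomp Require Import all_boot all_order all_algebra.
From mathcomp Require Import all_classical all_reals all_analysis.

Set Implicit Arguments.
Unset Strict Implicit.
Unset Printing Implicit Defensive.

Import Order.TTheory GRing.Theory Num.Theory.
Import numFieldNormedType.Exports.

Local Open Scope classical_set_scope.
Local Open Scope ring_scope.

(* [measurableTypeR R] is the carrier of [R] with its Borel sigma-algebra;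
   topologically [space3 R] is [R * R * R]. *)
Definition space3 (R : realType) : Type :=
  (measurableTypeR R * measurableTypeR R * measurableTypeR R)%type.

Definition vfield (R : realType) : Type := space3 R -> 'rV[R]_3.

Section Kernel.
Variable R : realType.
Implicit Types a t z : R.

(* Euler's integral, used only for a > 0. *)
Definition Gamma a : R :=
  \int[@lebesgue_measure R]_(t in `]0, +oo[) (t `^ (a - 1) * expR (- t)).

(* Three-parameter Mittag-Leffler (Prabhakar) function. *)
Definition prabhakar (gam rho mu z : R) : R :=
  (Gamma gam)^-1 *
  limn (series (fun k : nat =>
    Gamma (k%:R + gam) / Gamma (rho * k%:R + mu) * (z ^+ k / k`!%:R))).

(* Inverse Laplace transform of s |-> (1 + s ^ alpha) ^ (- beta), for t > 0. *)
Definition hn_kernel (alpha beta t : R) : R :=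
  t `^ (alpha * beta - 1) *
  prabhakar beta alpha (alpha * beta) (- (t `^ alpha)).

End Kernel.

Section Fields.
Variable R : realType.

Definition lebesgue3 : set (space3 R) -> \bar R :=
  ((@lebesgue_measure R \x @lebesgue_measure R) \x @lebesgue_measure R)%E.

HB.instance Definition _ := Measure.on lebesgue3.

Definition spatial_domain (Omega : set (R * R * R)) : Prop :=
  [/\ open Omega, connected Omega & Omega !=set0].

Definition dot (a b : 'rV[R]_3) : R := \sum_(i < 3) a 0 i * b 0 i.

Variable Omega : set (space3 R).
Implicit Types u v w : vfield R.

Definition L2field u : Prop :=
  forall i : 'I_3, ((fun x => u x 0 i) \_ Omega) \in Lfun lebesgue3 2%:E.

Definition L2dot u v : R := \int[lebesgue3]_(x in Omega) dot (u x) (v x).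

Definition L2norm u : R := Num.sqrt (L2dot u u).

Definition eqL2 u v : Prop :=
  {ae lebesgue3, forall x, Omega x -> u x = v x}.

Definition basis3 (i : 'I_3) : R * R * R :=
  ((i == 0)%:R, (i == 1)%:R, (i == 2%:R)%:R).

Definition partial (i : 'I_3) (f : R * R * R -> R) : R * R * R -> R :=
  fun x => 'D_(basis3 i) f x.

(* C^infty: every iterated partial derivative is differentiable everywhere. *)
Definition smooth (f : R * R * R -> R) : Prop :=
  forall (l : seq 'I_3) (x : R * R * R), differentiable (foldr partial f l) x.

(* Index arithmetic is modulo 3. *)
Definition curl u : vfield R := fun x =>
  \row_(i < 3) (partial (i + 1) (fun y => u y 0 (i + 2%:R)) x -
                partial (i + 2%:R) (fun y => u y 0 (i + 1)) x).

Definition test_field (phi : vfield R) : Prop :=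
  (forall i : 'I_3, smooth (fun x => phi x 0 i)) /\
  exists K : set (R * R * R),
    [/\ compact K, K `<=` Omega & forall x, ~ K x -> phi x = 0].

(* [v] lies in H(curl; Omega), with distributional curl [c]. *)
Definition weak_curl v c : Prop :=
  [/\ L2field v, L2field c &
    forall phi, test_field phi -> L2dot v (curl phi) = L2dot c phi].

(* The tangential trace n x v of v in H(curl; Omega), as the functional
   w |-> \int_{boundary} (n x v) . w that Green's formula extends from smooth
   fields to w in H(curl; Omega); [cv], [cw] are the curls of [v], [w]. *)
Definition tangential_trace v cv w cw : R := L2dot cv w - L2dot v cw.

Definition H0curl v : Prop :=
  exists2 cv, weak_curl v cv &
    forall w cw, weak_curl w cw -> tangential_trace v cv w cw = 0.

(* Continuity on [0, T] with values in L^2(Omega). *)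
Definition L2continuous (T : R) (u : R -> vfield R) : Prop :=
  (forall t, t \in `[0, T] -> L2field (u t)) /\
  forall t, t \in `[0, T] ->
    L2norm (fun x => u s x - u t x) @[s --> within `[0, T] (nbhs t)] --> (0 : R).

(* [du] is the L^2(Omega)-derivative at [t] of [u] on [0, T]
   (one-sided at the end points). *)
Definition L2derivative (T : R) (u : R -> vfield R) (t : R) du : Prop :=
  L2field du /\
  L2norm (fun x => (s - t)^-1 *: (u s x - u t x) - du x)
    @[s --> within `[0, T] (t^')] --> (0 : R).

End Fields.

(* Weak solutions: E, H, P are continuous on [0, T] with values in L^2(Omega),
   and at every t in (0, T] they have time derivatives in L^2(Omega), E(t) is
   in H_0(curl; Omega) and the three variational equations hold. *)
Record HN_solution (R : realType) (Omega : set (space3 R))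
    (T eps_s eps_inf alpha beta : R) (E0 H0 : vfield R)
    (E H P : R -> vfield R) : Prop := {
  HN_continuous :
    [/\ L2continuous Omega T E, L2continuous Omega T H
      & L2continuous Omega T P] ;
  HN_initial :
    [/\ eqL2 Omega (E 0) E0, eqL2 Omega (H 0) H0
      & eqL2 Omega (P 0) (fun=> 0)] ;
  HN_H0curl : forall t, t \in `]0, T] -> H0curl Omega (E t) ;
  HN_maxwell : forall t, t \in `]0, T] ->
    exists dE dH dP curlE : vfield R,
    [/\ [/\ L2derivative Omega T E t dE, L2derivative Omega T H t dH
          & L2derivative Omega T P t dP],
        weak_curl Omega (E t) curlE,
        (forall phi curl_phi,
           H0curl Omega phi -> weak_curl Omega phi curl_phi ->
           eps_inf * L2dot Omega dE phi + L2dot Omega dP phi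
             - L2dot Omega (H t) curl_phi = 0)
      & (forall psi, L2field Omega psi ->
           L2dot Omega dH psi + L2dot Omega curlE psi = 0)] ;
  HN_polarization : forall t, t \in `]0, T] ->
    forall phi, L2field Omega phi ->
      L2dot Omega (P t) phi
      - (eps_s - eps_inf) *
        \int[@lebesgue_measure R]_(s in `[0, t])
          (hn_kernel alpha beta (t - s) * L2dot Omega (E s) phi) = 0
}.

Definition HN_energy (R : realType) (Omega : set (space3 R))
    (eps_s eps_inf alpha beta : R) (E H : R -> vfield R) (t : R) : R :=
  eps_inf * L2norm Omega (E t) ^+ 2 + L2norm Omega (H t) ^+ 2
  + (eps_s - eps_inf) *
    \int[@lebesgue_measure R]_(s in `[0, t])
      (hn_kernel alpha beta (t - s) * L2norm Omega (E s) ^+ 2).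

(* Main.v *)
Require Import Defs.
From mathcomp Require Import all_boot all_order all_algebra.
From mathcomp Require Import all_classical all_reals all_analysis.
From mathcomp Require Import measurable_realfun.
From mathcomp Require Import ring lra.

(** Testing the first equation with E and the second with H cancels the curl
terms, so that (eps_inf |E|^2 + |H|^2)' / 2 = - (P', E). What remains is the
inequality 2 (P', E) >= De (w * |E|^2)', with De = eps_s - eps_inf and w the
kernel; it needs of w only that it is nonnegative, nonincreasing and locally
integrable. Put D(t) = \int_0^t w(t - s) |E(s) - E(t0)|^2 ds with t0 fixed.
Expanding the square,
D(t) = (w * |E|^2)(t) - 2 (w * E, E(t0))(t) + |E(t0)|^2 \int_0^t w.
Between t0 - h and t0 the last term increases, since w >= 0. Since w is
nonincreasing, D increases by at most \int_(t0 - h)^t0 w(t0 - s)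
|E(s) - E(t0)|^2 ds = o(h), as E is Lipschitz at t0. Hence w * |E|^2, which
may fail to be differentiable, increases by at most 2 (P(t0) - P(t0 - h), E(t0)) /
De + o(h). So the upper left Dini derivative of the energy is nonpositive on
(0, T]; the energy is also upper semicontinuous from the right, and therefore
nonincreasing: see [dini_nonincreasing], [memory_step] and
[memory_energy_nonincreasing].

The rest of the work is the sign and the monotonicity of w, which is only known
as a power series. Let k_b be the inverse Laplace transform of
K_b(s) = (1 + s^alpha)^(-b), for every b > 0. Termwise integration gives, for
s > 1, the integral of t^n exp (- s t) k_b(t), that is
(-1)^n times the n-th derivative of K_b at s. It is nonnegative: the functions
s^(- nu) K_b with nu >= 0 are positive, and minus the derivative of one of them
is a combination of two of them with nonnegative coefficients; at the level of
the coefficients this is [negbin_rising_series]. As t^n exp (- n t / t0)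
concentrates at t0 when n grows, k_b >= 0 ([ge0_of_laplace_moments]). Finally,
d/ds (s K_b) = (1 - alpha b) K_b + alpha b K_(b + 1) reads
- t k_b'(t) = (1 - alpha b) k_b(t) + alpha b k_(b + 1)(t), so the positivity of
the kernels for all b > 0 makes w = k_beta nonincreasing. *)

Set Implicit Arguments.
Unset Strict Implicit.
Unset Printing Implicit Defensive.

Import Order.TTheory GRing.Theory Num.Theory.
Import numFieldNormedType.Exports.

Local Open Scope classical_set_scope.
Local Open Scope ring_scope.

(** * Reflection and scaling of the Lebesgue measure *)

Section ChangeOfVariable.
Variable R : realType.
Local Notation mu := (@lebesgue_measure R).

Lemma integral_reflection (c : R) (D : set R) (f : R -> \bar R) :
  measurable D -> measurable_fun D f -> {in D, forall x, (0 <= f x)%E} ->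
  (\int[mu]_(x in D) f x
   = \int[mu]_(x in (fun x : R => (c - x)%R) @^-1` D) f (c - x)%R)%E.
Proof.
move=> mD mf f0.
have mphi : measurable_fun [set: measurableTypeR R]
    ((fun x => c - x) : measurableTypeR R -> measurableTypeR R).
  exact: measurable_funB.
rewrite -(ge0_integral_pushforward mphi)//.
apply: eq_measure_integral => //= A mA _.
apply: lebesgue_measure_unique => //= _ [[a b]] _ <-.
rewrite /pushforward.
have -> : (fun x => c - x) @^-1` `]a, b] = `[c - b, c - a[%classic.
  by apply/seteqP; split => x /=; rewrite !in_itv/=; lra.
by rewrite !lebesgue_measure_itv/= !lte_fin ltrD2l ltrN2; case: ifP => // _;
  rewrite -!EFinB; congr EFin; lra.
Qed.

Lemma integral_scaling (s : R) (f : R -> \bar R) : 0 < s ->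
  measurable_fun (`]0, +oo[ : set R) f -> {in `]0, +oo[, forall x, (0 <= f x)%E} ->
  (\int[mu]_(x in `]0%R, +oo[) f x
   = s%:E * \int[mu]_(x in `]0%R, +oo[) f (s * x)%R)%E.
Proof.
move=> s0 mf f0.
have mphi : measurable_fun [set: measurableTypeR R]
    ((fun x => s * x) : measurableTypeR R -> measurableTypeR R).
  exact: measurable_funM.
have preE : (fun x => s * x) @^-1` `]0, +oo[ = `]0, +oo[%classic.
  by apply/seteqP; split => x /=; rewrite !in_itv/= !andbT pmulr_rgt0.
have s0' : 0 <= s by exact: ltW.
have := ge0_integral_pushforward mphi mu (D := `]0, +oo[%classic)
  (f := f) (measurable_itv _) mf.
rewrite preE => <-; last by move=> x; rewrite inE => ?; apply: f0.
rewrite -[s]/((NngNum s0')%:num).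
rewrite -ge0_integral_mscale//.
apply: eq_measure_integral => //= A mA _.
apply: lebesgue_measure_unique => //= _ [[a b]] _ <-.
rewrite /mscale/= /pushforward.
rewrite (_ : _ @^-1` _ = `]s^-1 * a, s^-1 * b]%classic); last first.
  apply/seteqP; split => x /=; rewrite !in_itv/= ?ltr_pdivrMl ?ler_pdivlMl//.
rewrite !lebesgue_measure_itv/= !lte_fin ltr_pM2l ?invr_gt0//.
case: ifP => // _; last by rewrite mule0.
rewrite -!EFinB -EFinM; congr EFin.
by rewrite mulrBr !mulrA mulfV ?gt_eqF// !mul1r.
Qed.

End ChangeOfVariable.

(** * The Gamma function *)

Section GammaFunction.
Variable R : realType.
Local Notation mu := (@lebesgue_measure R).
Implicit Types a s t : R.

Definition gamma_density a t : R := t `^ (a - 1) * expR (- t).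

Definition gamma_integral a : \bar R :=
  (\int[mu]_(t in `]0%R, +oo[) (gamma_density a t)%:E)%E.

Lemma gamma_density_ge0 a t : 0 <= gamma_density a t.
Proof. by rewrite mulr_ge0 ?powR_ge0 ?expR_ge0. Qed.

Lemma measurable_gamma_density a (D : set R) :
  measurable_fun D (gamma_density a).
Proof.
apply: measurable_funTS; apply: measurable_funM.
  exact: measurable_powR.
by apply: measurableT_comp => //; exact: measurable_oppr.
Qed.

Lemma continuous_powR_pos a t : 0 < t -> {for t, continuous (fun x : R => x `^ a)}.
Proof.
move=> t0; apply/differentiable_continuous/derivable1_diffP.
by have [] := is_derive1_powR a t0.
Qed.

Lemma continuous_gamma_density a t :
  0 < t -> {for t, continuous (gamma_density a)}.
Proof.
move=> t0; apply: continuousM; first exact: continuous_powR_pos.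
apply: continuous_comp; last exact: continuous_expR.
exact: opp_continuous.
Qed.

Lemma is_derive_gamma_density a t : 0 < t ->
  is_derive t (1 : R) (gamma_density (a + 1))
    (a * gamma_density a t - gamma_density (a + 1) t).
Proof.
move=> t0; rewrite /gamma_density addrK.
have h1 := is_derive1_powR a t0.
apply: is_derive_eq; rewrite /GRing.scale/=.
ring.
Qed.

(** The density is only continuous away from 0, so Euler's integral is approached
from the compact intervals F n. *)
Let F n : set R := `[n.+2%:R^-1, n.+2%:R]%classic.

Let F_pos n t : F n t -> 0 < t.
Proof. by rewrite /F/= in_itv/= => /andP[+ _]; apply: lt_le_trans; rewrite invr_gt0. Qed.

Let within_F n (f : R -> R) : (forall t, 0 < t -> {for t, continuous f}) ->
  {within F n, continuous f}.
Proof.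
move=> cf; apply: continuous_in_subspaceT => t; rewrite inE => Ft.
exact/cf/(F_pos Ft).
Qed.

Let integrable_F n a : mu.-integrable (F n) (EFin \o gamma_density a).
Proof.
apply: continuous_compact_integrable; first exact: segment_compact.
by apply: within_F => t; exact: continuous_gamma_density.
Qed.

(** By integration by parts; the last two terms are the boundary values. *)
Let truncated_rec a n :
  a * (\int[mu]_(t in F n) gamma_density a t)
  = (\int[mu]_(t in F n) gamma_density (a + 1) t)
    + (gamma_density (a + 1) n.+2%:R - gamma_density (a + 1) n.+2%:R^-1).
Proof.
have lt12 : (n.+2%:R^-1 : R) < n.+2%:R.
  by rewrite (@lt_le_trans _ _ 1)// ?invf_lt1// ?ltr1n// ler1n.
have mF : measurable (F n : set (measurableTypeR R)) by exact: measurable_itv.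
rewrite -RintegralZl//.
apply/eqP; rewrite addrC -subr_eq; apply/eqP.
rewrite -RintegralB//=; last first.
  exact: integrableZl mF a _ (integrable_F n a).
rewrite /Rintegral (@continuous_FTC2 _ _ (gamma_density (a + 1)))//.
- apply: within_F => t t0; apply: continuousB; last exact: continuous_gamma_density.
  by apply: continuousM; [exact: cst_continuous|exact: continuous_gamma_density].
- split.
  + move=> t /subset_itv_oo_cc /F_pos t0.
    by have [] := is_derive_gamma_density a t0.
  + by apply: cvg_at_right_filter; apply: continuous_gamma_density; rewrite invr_gt0.
  + by apply: cvg_at_left_filter; apply: continuous_gamma_density.
- move=> t /subset_itv_oo_cc /F_pos t0; rewrite derive1E.
  by have h := is_derive_gamma_density a t0; exact: derive_val.
Qed.

Let nondecreasing_F : nondecreasing_seq F.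
Proof.
move=> m n mn; rewrite subsetEset => x; rewrite /F/= !in_itv/= => /andP[h1 h2].
have mn' : (m.+2%:R : R) <= n.+2%:R by rewrite ler_nat.
by rewrite (le_trans _ h1) ?(le_trans h2)// lef_pV2// posrE.
Qed.

Let bigcup_F : \bigcup_n F n = `]0, +oo[%classic.
Proof.
apply/seteqP; split => [x [n _] /F_pos x0|x]; rewrite /= in_itv/= andbT// => x0.
exists (Num.trunc (Num.max x x^-1)) => //; rewrite /F/= in_itv/=.
set M := Num.max x x^-1.
have Mlt : M < (Num.trunc M).+2%:R.
  apply: (lt_le_trans (truncnS_gt M)).
  by rewrite ler_nat.
have hx : x <= M by rewrite le_max lexx.
have hx1 : x^-1 <= M by rewrite le_max lexx orbT.
rewrite (le_trans hx (ltW Mlt)) andbT -[leRHS]invrK lef_pV2 ?posrE ?invr_gt0//.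
exact: le_trans hx1 (ltW Mlt).
Qed.

Let truncated_cvg a :
  (\int[mu]_(t in F n) (gamma_density a t)%:E)%E @[n --> \oo]
  --> gamma_integral a.
Proof.
rewrite /gamma_integral -bigcup_F.
apply: ge0_nondecreasing_set_cvg_integral => //.
- by move=> n; exact: measurable_itv.
- by move=> n; apply/measurable_EFinP; exact: measurable_gamma_density.
- by move=> n x _; rewrite lee_fin gamma_density_ge0.
Qed.

Let cvg_inv_powR (b : R) : 0 < b -> (n.+2%:R^-1 : R) `^ b @[n --> \oo] --> (0 : R).
Proof.
move=> b0; have /cvg_at_rightP := powR_cvg0 b0; apply; split=> [n|].
  by rewrite invr_gt0.
by have := @cvg_harmonic R; rewrite -cvg_shiftS; apply.
Qed.

Let boundary_small a : 0 < a -> gamma_density (a + 1) n.+2%:R^-1 @[n --> \oo] --> (0 : R).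
Proof.
move=> a0; apply: (squeeze_cvgr _ (cvg_cst 0) (cvg_inv_powR a0)).
near=> n; rewrite gamma_density_ge0/= /gamma_density addrK ler_piMr ?powR_ge0//.
Unshelve. all: by end_near. Qed.

(** Because exp (- x) <= m! / x^m for a natural number m > a. *)
Let boundary_large a : 0 < a -> gamma_density (a + 1) n.+2%:R @[n --> \oo] --> (0 : R).
Proof.
move=> a0; set m := (Num.trunc a).+1.
have am : a < m%:R by exact: truncnS_gt.
have am0 : 0 < m%:R - a by rewrite subr_gt0.
have h : m`!%:R * ((n.+2%:R^-1 : R) `^ (m%:R - a)) @[n --> \oo] --> (0 : R).
  by rewrite -[X in _ --> X](mulr0 m`!%:R); apply: cvgMr; exact: cvg_inv_powR.
apply: (squeeze_cvgr _ (cvg_cst 0) h).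
near=> n; rewrite gamma_density_ge0/= /gamma_density addrK.
set x : R := n.+2%:R; have x0 : 0 < x by [].
have xa : x `^ a = x ^+ m * x^-1 `^ (m%:R - a).
  rewrite -(powR_inv1 (ltW x0)) -powRrM mulN1r opprB powRB; last by rewrite (gt_eqF x0) implybT.
  by rewrite powR_mulrn ?(ltW x0)// mulrC divfK// gt_eqF// exprn_gt0.
rewrite xa mulrAC ler_wpM2r ?powR_ge0// expRN ler_pdivrMr ?expR_gt0//.
rewrite -ler_pdivrMl ?ltr0n ?fact_gt0// mulrC.
by apply: le_trans (expR_ge1Dxn m.-1 (ltW x0)); rewrite lerDr.
Unshelve. all: by end_near. Qed.

(** Stated in the extended reals, so that it also transports finiteness from one
side to the other. *)
Lemma gamma_integral_rec a : 0 < a ->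
  (gamma_integral (a + 1) = a%:E * gamma_integral a)%E.
Proof.
move=> a0.
have mF n : measurable (F n : set (measurableTypeR R)) by exact: measurable_itv.
have fin n b : (\int[mu]_(t in F n) (gamma_density b t)%:E)%E \is a fin_num.
  by have := integrable_F n b; exact: integrable_fin_num.
pose u n : R := gamma_density (a + 1) n.+2%:R - gamma_density (a + 1) n.+2%:R^-1.
have u0 : (EFin \o u) @ \oo --> 0%:E.
  apply: cvg_EFin; first exact: nearW.
  by rewrite -(subr0 (0 : R)); exact: cvgB (boundary_large a0) (boundary_small a0).
have h1 : (\int[mu]_(t in F n) (gamma_density (a + 1) t)%:E + (u n)%:E)%E
    @[n --> \oo] --> gamma_integral (a + 1).
  rewrite -[X in _ --> X]adde0; apply: cvgeD => //.
  by rewrite fin_num_adde_defl.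
have h2 := cvgeZl (isT : a%:E \is a fin_num) (@truncated_cvg a).
move: h1; under eq_cvg => n.
  rewrite -[X in (X + _)%E]fineK// -EFinD -truncated_rec EFinM [X in (_ * X)%E]fineK//.
  over.
by move=> h1; exact: cvg_unique h1 h2.
Qed.

Lemma gamma_integral1 : gamma_integral 1 = 1%E.
Proof.
rewrite /gamma_integral integral_itv_obnd_cbnd; last first.
  by apply/measurable_EFinP; exact: measurable_gamma_density.
under eq_integral => t _ do rewrite /gamma_density subrr powRr0 mul1r.
have cE : continuous (fun t : R => expR (- t)).
  by move=> t; apply: continuous_comp; [exact: opp_continuous|exact: continuous_expR].
rewrite (@ge0_continuous_FTC2y _ _ (fun t : R => - expR (- t)) 0 0)//.
- by rewrite oppr0 expR0 sub0e -EFinN opprK.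
- exact: continuous_subspaceT.
- by rewrite -oppr0; apply: cvgN; exact: cvgr_expR.
- by apply: cvg_at_right_filter; apply: cvgN; exact: cE.
- by move=> t _; rewrite derive1E derive_val ?/GRing.scale/=; ring.
Qed.

Lemma gamma_integral_ge0 a : (0 <= gamma_integral a)%E.
Proof. by apply: integral_ge0 => t _; rewrite lee_fin gamma_density_ge0. Qed.

(** The recurrence reaches the natural numbers from 1; for real a >= 1 the
density lies below the sum of those of 1 and of some n + 1; and the recurrence
comes back from a + 1 to a < 1. *)
Lemma gamma_integral_fin a : 0 < a -> gamma_integral a \is a fin_num.
Proof.
suff H b : 1 <= b -> gamma_integral b \is a fin_num.
  move=> a0; have [/H//|a1] := leP 1 a.
  have := H (a + 1); rewrite lerDr (ltW a0) gamma_integral_rec// => /(_ isT).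
  rewrite !ge0_fin_numE ?mule_ge0 ?lee_fin ?gamma_integral_ge0 ?(ltW a0)//.
  case: (gamma_integral a) (gamma_integral_ge0 a) => [r _ _|_|//].
    by rewrite ltry.
  by rewrite gt0_muley ?lte_fin.
have Hn n : gamma_integral n.+1%:R \is a fin_num.
  elim: n => [|n IH]; first by rewrite gamma_integral1.
  by rewrite -natr1 gamma_integral_rec// fin_numM.
move=> b1; pose n := Num.trunc b.
have bn : b <= n.+1%:R by apply: ltW; exact: truncnS_gt.
rewrite ge0_fin_numE ?gamma_integral_ge0//.
apply: (@le_lt_trans _ _ (gamma_integral 1 + gamma_integral n.+1%:R)%E).
  rewrite /gamma_integral -ge0_integralD//=; last 4 first.
  - by move=> t _; rewrite lee_fin gamma_density_ge0.
  - by apply/measurable_EFinP; exact: measurable_gamma_density.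
  - by move=> t _; rewrite lee_fin gamma_density_ge0.
  - by apply/measurable_EFinP; exact: measurable_gamma_density.
  apply: ge0_le_integral => //.
  - by move=> t _; rewrite lee_fin gamma_density_ge0.
  - by apply/measurable_EFinP; exact: measurable_gamma_density.
  - apply: emeasurable_funD;
      by apply/measurable_EFinP; exact: measurable_gamma_density.
  move=> t; rewrite /= in_itv/= andbT => t0.
  rewrite -EFinD lee_fin /gamma_density -mulrDl ler_wpM2r ?expR_ge0//.
  rewrite subrr powRr0; have [t1|/ltW t1] := leP t 1.
    rewrite ler_wpDr ?powR_ge0//.
    apply: (@le_trans _ _ (1 `^ (b - 1))); last by rewrite powR1.
    by apply: ge0_ler_powR; rewrite ?subr_ge0 ?nnegrE// ltW.
  by rewrite ler_wpDl//; apply: ler_powR => //; rewrite lerD2r.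
by rewrite lte_add_pinfty// -ge0_fin_numE ?gamma_integral_ge0// gamma_integral1.
Qed.

Lemma GammaE a : Gamma a = fine (gamma_integral a). Proof. by []. Qed.

Lemma gamma_integralE a : 0 < a -> gamma_integral a = (Gamma a)%:E.
Proof. by move=> a0; rewrite GammaE fineK// gamma_integral_fin. Qed.

Lemma Gamma_rec a : 0 < a -> Gamma (a + 1) = a * Gamma a.
Proof.
move=> a0; apply: EFin_inj; rewrite EFinM -!gamma_integralE ?addr_gt0//.
exact: gamma_integral_rec.
Qed.

End GammaFunction.

Section LaplacePower.
Variable R : realType.
Local Notation mu := (@lebesgue_measure R).
Implicit Types a s t : R.

Lemma Gamma_gt0 a : 0 < a -> 0 < Gamma a.
Proof.
suff H (b : R) : 1 <= b -> 0 < Gamma b.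
  move=> a0; have [/H//|a1] := leP 1 a.
  have := H (a + 1); rewrite lerDr (ltW a0) Gamma_rec// => /(_ isT).
  by rewrite pmulr_rgt0.
move=> b1; have b0 : 0 < b by exact: lt_le_trans b1.
rewrite -lte_fin -gamma_integralE//.
apply: (@lt_le_trans _ _ (\int[mu]_(t in `[1%R, 2%R]) (expR (- 2))%:E)%E).
  rewrite integral_cst ?measurable_itv//= lebesgue_measure_itv/= lte_fin ltr1n.
  by rewrite -EFinB -EFinM lte_fin mulr_gt0 ?expR_gt0//; lra.
apply: (@le_trans _ _ (\int[mu]_(t in `[1%R, 2%R]) (gamma_density b t)%:E)%E).
  apply: ge0_le_integral => //.
    by apply/measurable_EFinP; exact: measurable_gamma_density.
  move=> t; rewrite /= in_itv/= => /andP[t1 t2]; rewrite lee_fin.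
  apply: (@le_trans _ _ (expR (- t))); first by rewrite ler_expR lerN2.
  rewrite /gamma_density ler_peMl ?expR_ge0//.
  apply: (@le_trans _ _ (t `^ 0)); first by rewrite powRr0.
  by apply: ler_powR => //; rewrite subr_ge0.
apply: ge0_subset_integral => //=.
- by apply/measurable_EFinP; exact: measurable_gamma_density.
- by move=> t _; rewrite lee_fin gamma_density_ge0.
- by move=> t /=; rewrite !in_itv/= andbT => /andP[+ _]; apply: lt_le_trans.
Qed.

(** Euler's integral rescaled by s; all Laplace transforms below reduce to it
term by term. *)
Lemma laplace_powR a s : 0 < a -> 0 < s ->
  (\int[mu]_(t in `]0%R, +oo[) (t `^ (a - 1) * expR (- (s * t)))%:E
   = (Gamma a / s `^ a)%:E)%E.
Proof.
move=> a0 s0.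
have m : measurable_fun (`]0, +oo[ : set R)
    (fun t => (t `^ (a - 1) * expR (- (s * t)))%:E).
  apply/measurable_EFinP/measurable_funTS/measurable_funM.
    exact: measurable_powR.
  by apply: measurableT_comp => //; apply: measurableT_comp => //; exact: measurable_funM.
set I := integral _ _ _.
suff e : (Gamma a)%:E = ((s `^ a)%:E * I)%E.
  by rewrite EFinM e muleAC -EFinM mulfV ?mul1e// powR_eq0 gt_eqF.
rewrite -gamma_integralE// /gamma_integral (integral_scaling s0); last 2 first.
- by apply/measurable_EFinP; exact: measurable_gamma_density.
- by move=> x _; rewrite lee_fin gamma_density_ge0.
under [in LHS]eq_integral => t.
  rewrite inE/= in_itv/= andbT => t0.
  rewrite /gamma_density powRM ?(ltW s0) ?(ltW t0)// -mulrA EFinM.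
  over.
rewrite ge0_integralZl//; last 2 first.
- by move=> t _; rewrite lee_fin mulr_ge0 ?powR_ge0 ?expR_ge0.
- by rewrite lee_fin powR_ge0.
by rewrite muleA -EFinM mulr_powRB1 ?(ltW s0).
Qed.

End LaplacePower.

(** * Termwise integration of series *)

Section TermwiseIntegration.
Variable R : realType.
Implicit Types u : nat -> R.

Lemma nneseries_lty u : (forall n, 0 <= u n) -> cvgn (series u) ->
  (\sum_(0 <= n <oo) (u n)%:E = (limn (series u))%:E)%E.
Proof.
move=> u0 cu; rewrite -EFin_lim//; congr (limn _).
by apply/funext => n /=; rewrite /series/= sumEFin.
Qed.

Lemma nneseries_cvg u : (forall n, 0 <= u n) ->
  (\sum_(0 <= n <oo) (u n)%:E < +oo)%E -> cvgn (series u).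
Proof.
move=> u0 su; apply: nondecreasing_is_cvgn.
  by apply/nondecreasing_seqP => n; rewrite /series/= big_nat_recr//= lerDl.
exists (fine (\sum_(0 <= n <oo) (u n)%:E)%E) => _ [n _ <-].
have s0 : (0 <= \sum_(0 <= n <oo) (u n)%:E)%E.
  by apply: nneseries_ge0 => k _ _; rewrite lee_fin.
rewrite -lee_fin fineK ?ge0_fin_numE// /series/= -sumEFin.
by apply: nneseries_lim_ge => k _ _; rewrite lee_fin.
Qed.

Variables (d : measure_display) (T : measurableType d).
Variables (mu : {measure set T -> \bar R}) (D : set T) (mD : measurable D).
Variable f : nat -> T -> R.
Hypothesis intf : forall n, mu.-integrable D (EFin \o f n).

Let integrable_partial n :
  mu.-integrable D (EFin \o (fun t => series (fun k => f k t) n)).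
Proof.
elim: n => [|n IH].
  by apply: eq_integrable (integrable0 _ _) => // t _; rewrite /series/= big_geq.
apply: eq_integrable (integrableD mD IH (intf n)) => // t _.
by rewrite /series/= big_nat_recr.
Qed.

Let Rintegral_partial n : series (fun k => \int[mu]_(t in D) f k t) n
  = \int[mu]_(t in D) series (fun k => f k t) n.
Proof.
elim: n => [|n IH].
  rewrite /series/= big_geq// /Rintegral integral0_eq// => t _.
  by rewrite big_geq.
rewrite /series/= big_nat_recr//= -[X in X + _]/(series _ n) IH.
rewrite -RintegralD//; apply: eq_Rintegral => t _.
by rewrite /series/= big_nat_recr.
Qed.

(** Partial sums of nonnegative terms stay below the integral of the sum. This
yields the summability of coefficients without estimates of the Gamma function. *)
Lemma ge0_cvg_series_integral (F : T -> R) :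
  (forall n t, D t -> 0 <= f n t) -> mu.-integrable D (EFin \o F) ->
  (forall t, D t -> series (fun n => f n t) n @[n --> \oo] --> F t) ->
  cvgn (series (fun n => \int[mu]_(t in D) f n t)).
Proof.
move=> f0 intF fF; apply: nondecreasing_is_cvgn.
  apply/nondecreasing_seqP => n; rewrite /series/= big_nat_recr//= lerDl.
  by apply: Rintegral_ge0 => t; exact: f0.
exists (\int[mu]_(t in D) F t) => _ [n _ <-].
rewrite Rintegral_partial; apply: le_Rintegral => // t Dt.
rewrite -(cvg_lim _ (fF t Dt))//; apply: nondecreasing_cvgn_le; last first.
  by apply/cvg_ex; exists (F t); exact: fF.
by apply/nondecreasing_seqP => k; rewrite /series/= big_nat_recr//= lerDl f0.
Qed.

Hypothesis sumf : cvgn (series (fun n => \int[mu]_(t in D) `|f n t|)).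

Let mf n : measurable_fun D (f n).
Proof. by apply/measurable_EFinP; apply: measurable_int (intf n). Qed.

Let g t := (\sum_(0 <= n <oo) `|f n t|%:E)%E.

Let integrable_g : mu.-integrable D g.
Proof.
apply/integrableP; split.
  apply: ge0_emeasurable_sum => // n _.
  by apply/measurable_EFinP; exact: measurableT_comp.
under eq_integral => t _.
  rewrite gee0_abs; last by apply: nneseries_ge0.
  over.
rewrite integral_nneseries//; last first.
  by move=> n; apply/measurable_EFinP; exact: measurableT_comp.
rewrite (_ : (\sum_(_ <= n <oo) _ = \sum_(0 <= n <oo) (\int[mu]_(t in D) `|f n t|)%:E)%E).
  by rewrite nneseries_lty ?ltry// => n; apply: Rintegral_ge0.
apply: eq_eseriesr => n _; rewrite /Rintegral fineK//.
by apply: integrable_fin_num => //; exact: integrable_norm.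
Qed.

(** Almost everywhere finiteness of the integrable sum of the absolute values. *)
Lemma ae_cvg_series : {ae mu, forall t, D t -> cvgn (series (fun n => `|f n t|))}.
Proof.
apply: filterS (integrable_ae mD integrable_g) => t h Dt.
apply: nneseries_cvg => //; have := h Dt.
by rewrite ge0_fin_numE// nneseries_ge0.
Qed.

(** Dominated convergence, the partial sums being dominated by the sum of the
absolute values. *)
Lemma integral_series (F : T -> R) :
  (forall t, D t -> series (fun n => f n t) n @[n --> \oo] --> F t) ->
  mu.-integrable D (EFin \o F) /\
  series (fun n => \int[mu]_(t in D) f n t) n @[n --> \oo]
    --> \int[mu]_(t in D) F t.
Proof.
move=> fF.
pose S n t := series (fun k => f k t) n.
have intS n : mu.-integrable D (EFin \o S n) by exact: integrable_partial.
have mS n : measurable_fun D (S n).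
  by apply/measurable_EFinP; apply: measurable_int (intS n).
have mF : measurable_fun D F by exact: (measurable_fun_cvg mS).
have mS' n : measurable_fun D (EFin \o S n) by exact/measurable_EFinP.
have mF' : measurable_fun D (EFin \o F) by exact/measurable_EFinP.
have cS : {ae mu, forall t, D t -> (EFin \o S n) t @[n --> \oo] --> (EFin \o F) t}.
  by apply/aeW => t Dt; apply: cvg_EFin; [exact: nearW|exact: fF].
have dS : {ae mu, forall t, forall n, D t -> (`|(EFin \o S n) t| <= g t)%E}.
  apply/aeW => t n Dt; rewrite /S /series/=.
  apply: (@le_trans _ _ (\sum_(0 <= k < n) `|f k t|%:E)%E).
    by rewrite sumEFin lee_fin ler_norm_sum.
  by apply: nneseries_lim_ge.
have [intF _ cvS] := dominated_convergence mD mS' mF' cS integrable_g dS.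
split=> //.
rewrite (funext Rintegral_partial).
by apply: fine_cvg; rewrite /Rintegral fineK//; exact: integrable_fin_num.
Qed.

End TermwiseIntegration.

(** * The binomial series *)

Section BinomialSeries.
Variable R : realType.
Local Notation mu := (@lebesgue_measure R).
Local Notation pos := (`]0%R, +oo[%classic : set (measurableTypeR R)).
Implicit Types a b s t z nu : R.

Let mpos : measurable pos. Proof. exact: measurable_itv. Qed.

Lemma powRD_gt0 (u r s : R) : 0 < u -> u `^ (r + s) = u `^ r * u `^ s.
Proof. by move=> u0; rewrite powRD// (gt_eqF u0) implybT. Qed.

Lemma integrable_laplace_powR c a s : 0 < a -> 0 < s ->
  mu.-integrable pos (EFin \o (fun t => c * (t `^ (a - 1) * expR (- (s * t))))).
Proof.
move=> a0 s0.
suff h : mu.-integrable pos (EFin \o (fun t => t `^ (a - 1) * expR (- (s * t)))).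
  exact: integrableZl mpos c _ h.
apply/integrableP; split.
  apply/measurable_EFinP/measurable_funTS/measurable_funM.
    exact: measurable_powR.
  by apply: measurableT_comp => //; apply: measurableT_comp => //; exact: measurable_funM.
under eq_integral => t _.
  rewrite gee0_abs ?lee_fin ?mulr_ge0 ?powR_ge0 ?expR_ge0//.
  over.
by rewrite laplace_powR// ltry.
Qed.

Lemma Rintegral_laplace_powR c a s : 0 < a -> 0 < s ->
  \int[mu]_(t in pos) (c * (t `^ (a - 1) * expR (- (s * t))))
  = c * (Gamma a / s `^ a).
Proof.
move=> a0 s0; rewrite RintegralZl//; last first.
  rewrite (_ : _ \o _ = EFin \o (fun t => 1 * (t `^ (a - 1) * expR (- (s * t))))).
    exact: integrable_laplace_powR.
  by apply/funext => t /=; rewrite mul1r.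
by rewrite /Rintegral laplace_powR.
Qed.

(** Coefficients of (1 - z) ^ (- b). *)
Definition negbin b (j : nat) : R := Gamma (j%:R + b) / (Gamma b * j`!%:R).

Lemma negbin_ge0 b j : 0 < b -> 0 <= negbin b j.
Proof. by move=> b0; rewrite divr_ge0// ?mulr_ge0// ltW// Gamma_gt0// ltr_wpDl. Qed.

(** In terms of generating functions, b (1 - z)^(- b) + z d/dz (1 - z)^(- b)
equals b (1 - z)^(- b - 1). *)
Lemma negbin_shift b j : 0 < b -> (j%:R + b) * negbin b j = b * negbin (b + 1) j.
Proof.
move=> b0; have jb : 0 < j%:R + b by rewrite ltr_wpDl.
rewrite /negbin addrA !Gamma_rec//.
have := lt0r_neq0 (Gamma_gt0 b0); have := lt0r_neq0 b0.
have : j`!%:R != 0 :> R by rewrite pnatr_eq0 -lt0n fact_gt0.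
move: (Gamma b) (Gamma _) (j`!%:R) => g1 g2 f f0 b_neq0 g10.
by field; rewrite f0 b_neq0 g10.
Qed.

Lemma negbinS b j : 0 < b -> j.+1%:R * negbin b j.+1 = b * negbin (b + 1) j.
Proof.
move=> b0; have jb : 0 < j%:R + b by rewrite ltr_wpDl.
rewrite /negbin factS natrM addrA.
have -> : j.+1%:R + b = j%:R + b + 1 by rewrite -natr1; ring.
rewrite !Gamma_rec//.
have := lt0r_neq0 (Gamma_gt0 b0); have := lt0r_neq0 b0.
have : j`!%:R != 0 :> R by rewrite pnatr_eq0 -lt0n fact_gt0.
have : j.+1%:R != 0 :> R by rewrite pnatr_eq0.
move: (j.+1%:R) (Gamma b) (Gamma _) (j`!%:R) => j1 g1 g2 f j10 f0 b_neq0 g10.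
by field; rewrite j10 f0 b_neq0 g10.
Qed.

Lemma expR_series z : series (fun j => z ^+ j / j`!%:R) n @[n --> \oo] --> expR z.
Proof. exact: is_cvg_series_exp_coeff. Qed.

(** The sum is (1 - z)^(- b), obtained by integrating the exponential series of
exp (z u) against u^(b - 1) exp (- u) / Gamma b: it is nonnegative
because the integrand is. *)
Lemma negbin_series b z : 0 < b -> `|z| < 1 ->
  exists2 l : R, 0 <= l & series (fun j => negbin b j * z ^+ j) n @[n --> \oo] --> l.
Proof.
move=> b0 z1.
pose f y (j : nat) (u : R) := (y ^+ j / (Gamma b * j`!%:R)) * (u `^ (j%:R + b - 1) * expR (- (1 * u))).
have jb (j : nat) : 0 < j%:R + b by rewrite ltr_wpDl.
have fE y j u : pos u -> f y j u = ((y * u) ^+ j / j`!%:R) * ((Gamma b)^-1 * (u `^ (b - 1) * expR (- (1 * u)))).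
  rewrite /= in_itv/= andbT => u0.
  rewrite /f -addrA (powRD_gt0 j%:R)// powR_mulrn ?(ltW u0)// exprMn.
  by field; rewrite !gt_eqF ?Gamma_gt0// ltr0n fact_gt0.
have intf y j : mu.-integrable pos (EFin \o f y j) by exact: integrable_laplace_powR.
have f_cvg y u : pos u -> series (fun j => f y j u) n @[n --> \oo] -->
    (Gamma b)^-1 * (u `^ (b - 1) * expR (- ((1 - y) * u))).
  move=> u0; rewrite (_ : series _ = (fun n => series (fun j => (y * u) ^+ j / j`!%:R) n * ((Gamma b)^-1 * (u `^ (b - 1) * expR (- (1 * u)))))); last first.
    apply/funext => n; rewrite /series/= mulr_suml.
    by apply: eq_bigr => j _; exact: fE.
  rewrite [X in _ --> X](_ : _ = expR (y * u) * ((Gamma b)^-1 * (u `^ (b - 1) * expR (- (1 * u))))).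
    by apply: cvgM; [exact: expR_series|exact: cvg_cst].
  rewrite (_ : - ((1 - y) * u) = y * u + - (1 * u)); last ring.
  by rewrite expRD; ring.
have Rf y j : \int[mu]_(u in pos) f y j u = negbin b j * y ^+ j.
  by rewrite Rintegral_laplace_powR// powR1 divr1 /negbin mulrAC [RHS]mulrAC [y ^+ j * _]mulrC.
have abs_cvg : cvgn (series (fun j => \int[mu]_(u in pos) `|f z j u|)).
  rewrite (_ : (fun j => _) = (fun j => \int[mu]_(u in pos) f `|z| j u)); last first.
    apply/funext => j; apply: eq_Rintegral => u _.
    rewrite /f !normrM normfV normrX [`|_ `^ _|]ger0_norm ?powR_ge0//.
    by rewrite [`|expR _|]ger0_norm ?expR_ge0// [`|_ * _%:R|]ger0_norm// mulr_ge0// ltW// Gamma_gt0.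
  apply: (ge0_cvg_series_integral mpos (intf `|z|) _ _ (f_cvg `|z|)) => //.
  - move=> j u _; rewrite /f mulr_ge0// ?divr_ge0 ?exprn_ge0 ?mulr_ge0 ?powR_ge0 ?expR_ge0//.
    by rewrite ltW// Gamma_gt0.
  - by apply: integrable_laplace_powR; rewrite ?subr_gt0.
have [_ lim_f] := integral_series mpos (intf z) abs_cvg (f_cvg z).
eexists; last first.
  by rewrite (_ : (fun j => negbin b j * z ^+ j) = (fun j => \int[mu]_(u in pos) f z j u)); [exact: lim_f|apply/funext => j; rewrite Rf].
apply: Rintegral_ge0 => u _.
by rewrite !mulr_ge0 ?powR_ge0 ?expR_ge0// invr_ge0 ltW// Gamma_gt0.
Qed.

Definition rising (x : R) n : R := \prod_(i < n) (x + i%:R).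

Lemma risingS x n : rising x n.+1 = x * rising (x + 1) n.
Proof.
rewrite /rising big_ord_recl/= addr0; congr (_ * _); apply: eq_bigr => i _.
by rewrite /bump/= natrD addrA.
Qed.

Lemma Gamma_rising x n : 0 < x -> Gamma (x + n%:R) = rising x n * Gamma x.
Proof.
elim: n x => [|n IH] x x0; first by rewrite /rising big_ord0 addr0 mul1r.
rewrite risingS (_ : x + n.+1%:R = x + 1 + n%:R); last by rewrite -natr1; ring.
rewrite IH; last by rewrite addr_gt0.
by rewrite (Gamma_rec x0) mulrA [x * _]mulrC.
Qed.

(** Up to a power of s, and for z = - s^(- alpha), the sum is (-1)^n times the
n-th derivative of s^(- nu) (1 + s^alpha)^(- b). Taking one factor out of the
rising product and splitting it as nu + alpha (j + b) expresses the sum for n + 1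
by those for n, with (nu + 1, b) and (nu + 1 - alpha, b + 1); the parameter nu
stays nonnegative because alpha <= 1. *)
Lemma negbin_rising_series alpha n b nu z : 0 < alpha <= 1 -> 0 < b -> 0 <= nu -> `|z| < 1 ->
  exists2 l : R, 0 <= l &
    series (fun j => negbin b j * rising (alpha * j%:R + alpha * b + nu) n * z ^+ j) m
      @[m --> \oo] --> l.
Proof.
move=> /andP[al0 al1]; elim: n b nu => [|n IH] b nu b0 nu0 z1.
  have [l l0 h] := negbin_series b0 z1; exists l => //.
  rewrite (_ : series _ = series (fun j => negbin b j * z ^+ j))//.
  by congr series; apply/funext => j; rewrite /rising big_ord0 mulr1.
have [l1 l10 h1] := IH b (nu + 1) b0 (addr_ge0 nu0 ler01) z1.
have b10 : 0 < b + 1 by rewrite addr_gt0.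
have nu1 : 0 <= nu + 1 - alpha by lra.
have [l2 l20 h2] := IH (b + 1) (nu + 1 - alpha) b10 nu1 z1.
exists (nu * l1 + alpha * b * l2).
  by rewrite addr_ge0// !mulr_ge0// ltW.
rewrite (_ : series _ = (fun m => nu * series (fun j => negbin b j *
      rising (alpha * j%:R + alpha * b + (nu + 1)) n * z ^+ j) m
    + alpha * b * series (fun j => negbin (b + 1) j *
      rising (alpha * j%:R + alpha * (b + 1) + (nu + 1 - alpha)) n * z ^+ j) m)).
  by apply: cvgD; apply: cvgM => //; exact: cvg_cst.
apply/funext => m.
rewrite /series/= !mulr_sumr -big_split/=; apply: eq_bigr => j _.
rewrite risingS.
have -> : alpha * j%:R + alpha * (b + 1) + (nu + 1 - alpha) = alpha * j%:R + alpha * b + nu + 1 by ring.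
have -> : alpha * j%:R + alpha * b + (nu + 1) = alpha * j%:R + alpha * b + nu + 1 by ring.
have := negbin_shift j b0.
set r := rising _ _; set c := negbin b j; set c' := negbin _ _; set w := z ^+ j => e.
have -> : alpha * b * (c' * r * w) = alpha * (b * c') * r * w by ring.
by rewrite -e; ring.
Qed.

End BinomialSeries.

(** * The Havriliak-Negami kernel and its Laplace transform *)

Section HavriliakNegamiKernel.
Variables (R : realType) (alpha : R).
Hypothesis alpha01 : 0 < alpha <= 1.
Local Notation mu := (@lebesgue_measure R).
Local Notation pos := (`]0%R, +oo[%classic : set (measurableTypeR R)).
Implicit Types b s t z : R.

Let alpha0 : 0 < alpha. Proof. by case/andP: alpha01. Qed.
Let alpha1 : alpha <= 1. Proof. by case/andP: alpha01. Qed.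
Let mpos : measurable pos. Proof. exact: measurable_itv. Qed.

Let order_gt0 b (j : nat) : 0 < b -> 0 < alpha * j%:R + alpha * b.
Proof. by move=> b0; rewrite ltr_wpDl ?mulr_gt0// mulr_ge0// ltW. Qed.

Definition prabhakar_coef b (j : nat) : R :=
  negbin b j / Gamma (alpha * j%:R + alpha * b).

Definition prabhakar_sum b z : R := limn (pseries (prabhakar_coef b) z).

Lemma prabhakar_coef_ge0 b j : 0 < b -> 0 <= prabhakar_coef b j.
Proof.
by move=> b0; rewrite divr_ge0 ?negbin_ge0// ltW// Gamma_gt0// order_gt0.
Qed.

(** Over j these terms sum to t^n exp (- s t) times the kernel when z = - 1, and to
a majorant of its absolute value when z = 1. *)
Let term b s n z j t : R :=
  prabhakar_coef b j * z ^+ j *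
  (t `^ (alpha * j%:R + alpha * b + n%:R - 1) * expR (- (s * t))).

Let integrable_term b s n z j : 0 < b -> 0 < s ->
  mu.-integrable pos (EFin \o term b s n z j).
Proof.
by move=> b0 s0; apply: integrable_laplace_powR => //; rewrite ltr_wpDr ?order_gt0.
Qed.

Let Rintegral_term b s n z j : 0 < b -> 0 < s ->
  \int[mu]_(t in pos) term b s n z j t
  = negbin b j * rising (alpha * j%:R + alpha * b + 0) n * (s `^ (- alpha) * z) ^+ j
    * s `^ (- (alpha * b + n%:R)).
Proof.
move=> b0 s0; have o0 := order_gt0 j b0.
rewrite /term Rintegral_laplace_powR//; last by rewrite ltr_wpDr.
rewrite Gamma_rising// -powRN.
rewrite (_ : - (alpha * j%:R + _ + _) = (- alpha) * j%:R + - (alpha * b + n%:R)); last ring.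
rewrite powRD_gt0// powRrM powR_mulrn ?powR_ge0// exprMn addr0 /prabhakar_coef.
by field; rewrite gt_eqF// Gamma_gt0.
Qed.

Let abs_Rintegral_term b s n z j : 0 < b -> 0 < s ->
  \int[mu]_(t in pos) `|term b s n z j t| = \int[mu]_(t in pos) term b s n `|z| j t.
Proof.
move=> b0 s0; apply: eq_Rintegral => t _.
rewrite /term normrM [X in X * _]normrM normrX [`|prabhakar_coef _ _|]ger0_norm ?prabhakar_coef_ge0//.
by rewrite [X in _ * X]ger0_norm// mulr_ge0 ?powR_ge0 ?expR_ge0.
Qed.

Let sum_term b s n z : 0 < b -> 1 < s -> `|z| <= 1 ->
  exists2 l : R, 0 <= l &
  series (fun j => \int[mu]_(t in pos) term b s n z j t) m @[m --> \oo] --> l.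
Proof.
move=> b0 s1 z1; have s0 : 0 < s by exact: lt_trans s1.
have [|l l0 hl] := @negbin_rising_series _ alpha n b 0 (s `^ (- alpha) * z) alpha01 b0 (lexx _).
  rewrite normrM ger0_norm ?powR_ge0//; apply: (@le_lt_trans _ _ (s `^ (- alpha))).
    by rewrite ler_piMr ?powR_ge0.
  by rewrite powRN invf_lt1 ?powR_gt0// /powR gt_eqF// expR_gt1 mulr_gt0// ln_gt0.
exists (l * s `^ (- (alpha * b + n%:R))); first by rewrite mulr_ge0 ?powR_ge0.
rewrite (_ : series _ = (fun m => series (fun j => negbin b j *
  rising (alpha * j%:R + alpha * b + 0) n * (s `^ (- alpha) * z) ^+ j) m * s `^ (- (alpha * b + n%:R)))).
  by apply: cvgM => //; exact: cvg_cst.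
apply/funext => m; rewrite /series/= mulr_suml; apply: eq_bigr => j _.
exact: Rintegral_term.
Qed.

Let cvg_abs_term b s n z : 0 < b -> 1 < s -> `|z| <= 1 ->
  cvgn (series (fun j => \int[mu]_(t in pos) `|term b s n z j t|)).
Proof.
move=> b0 s1 z1; have s0 : 0 < s by exact: lt_trans s1.
have [|l _ hl] := @sum_term b s n `|z| b0 s1; first by rewrite normr_id.
apply/cvg_ex; exists l; rewrite (_ : series _ = series (fun j => \int[mu]_(t in pos) term b s n `|z| j t))//.
by congr series; apply/funext => j; rewrite abs_Rintegral_term.
Qed.

Let termE b s n z j t : 0 < t -> term b s n z j t =
  prabhakar_coef b j * (z * t `^ alpha) ^+ j
  * (t `^ (alpha * b - 1) * (t ^+ n * expR (- (s * t)))).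
Proof.
move=> t0; rewrite /term.
rewrite (_ : _ - 1 = alpha * j%:R + (alpha * b - 1 + n%:R)); last ring.
rewrite !powRD_gt0// powRrM !powR_mulrn ?powR_ge0 ?(ltW t0)// exprMn.
ring.
Qed.

(** The Laplace transform of the series of absolute values is finite, so that
series converges at almost every t, hence at arbitrarily large ones, and a power
series converges inside. *)
Lemma cvg_prabhakar_sum b z : 0 < b -> cvgn (pseries (prabhakar_coef b) z).
Proof.
move=> b0; have s2 : (1 : R) < 2 by rewrite ltr1n.
have s0 : (0 : R) < 2 by [].
have one1 : `|1 : R| <= 1 by rewrite normr1.
have [N [mN N0 subN]] := ae_cvg_series mpos (fun j => @integrable_term b 2 0 1 j b0 s0)
  (@cvg_abs_term b 2 0 1 b0 s2 one1).
pose x0 := (`|z| + 1) `^ alpha^-1.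
have x0_gt0 : 0 < x0 by rewrite powR_gt0// ltr_wpDl.
have [t [xt ht]] : exists t, x0 < t /\ cvgn (series (fun j => `|term b 2 0 1 j t|)).
  apply: contrapT => H.
  suff : (mu `]x0, (x0 + 1)%R] <= mu N)%E.
    by rewrite N0 lebesgue_measure_itv/= lte_fin ltrDl ltr01 -EFinB lee_fin addrC addKr ler10.
  apply: le_measure; rewrite ?inE//.
  move=> t /=; rewrite in_itv/= => /andP[xt _]; apply: subN => /= h; apply: H.
  exists t; split => //; apply: h.
  by rewrite /= in_itv/= andbT; exact: lt_trans xt.
have t0 : 0 < t by exact: lt_trans xt.
apply: (@is_cvg_pseries_inside _ _ (t `^ alpha)); last first.
  rewrite [ltRHS]ger0_norm ?powR_ge0//.
  apply: (@lt_trans _ _ (`|z| + 1)); first by rewrite ltrDl.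
  rewrite (_ : `|z| + 1 = x0 `^ alpha); last first.
    by rewrite /x0 -powRrM mulVf ?gt_eqF// powRr1// addr_ge0.
  by apply: gt0_ltr_powR => //; rewrite nnegrE ltW.
pose C := t `^ (alpha * b - 1) * (t ^+ 0 * expR (- (2 * t))).
have C0 : 0 < C by rewrite !mulr_gt0 ?powR_gt0 ?expR_gt0.
rewrite (_ : pseries _ _ = (fun n => series (fun j => `|term b 2 0 1 j t|) n * C^-1)).
  by apply: is_cvgM => //; exact: is_cvg_cst.
apply/funext => n; rewrite /pseries /series/= mulr_suml; apply: eq_bigr => j _.
rewrite termE// -/C mul1r ger0_norm ?mulfK ?gt_eqF//.
by rewrite mulr_ge0 ?(ltW C0)// mulr_ge0 ?prabhakar_coef_ge0// exprn_ge0// powR_ge0.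
Qed.

Lemma pseries_diffs_prabhakar_coef b : 0 < b ->
  pseries_diffs (prabhakar_coef b) = (fun j => b * prabhakar_coef (b + 1) j).
Proof.
move=> b0; apply/funext => j; rewrite /pseries_diffs /prabhakar_coef.
rewrite mulrA negbinS// -mulrA; congr (_ * (_ / Gamma _)).
by rewrite -natr1; ring.
Qed.

Let cvg_pseriesZ c (f : nat -> R) z l :
  pseries f z n @[n --> \oo] --> l ->
  pseries (fun j => c * f j) z n @[n --> \oo] --> c * l.
Proof.
move=> h; rewrite (_ : pseries _ _ = (fun n => c * pseries f z n)).
  by apply: cvgM => //; exact: cvg_cst.
apply/funext => n; rewrite /pseries /series/= mulr_sumr.
by apply: eq_bigr => j _; rewrite mulrA.
Qed.

Lemma is_derive_prabhakar_sum b z : 0 < b ->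
  is_derive z (1 : R) (prabhakar_sum b) (b * prabhakar_sum (b + 1) z).
Proof.
move=> b0; have b1 : 0 < b + 1 by rewrite addr_gt0.
have zK : `|z| < `| `|z| + 1| by rewrite [ltRHS]ger0_norm ?addr_ge0// ltrDl.
have b2 : 0 < b + 1 + 1 by rewrite addr_gt0.
have cvgZ c d K : 0 < d -> cvgn (pseries (fun j => c * prabhakar_coef d j) K).
  move=> d0; apply/cvg_ex; eexists; apply: cvg_pseriesZ.
  exact: cvg_prabhakar_sum.
have dE := pseries_diffs_prabhakar_coef b0.
have ddE : pseries_diffs (pseries_diffs (prabhakar_coef b))
    = (fun j => b * (b + 1) * prabhakar_coef (b + 1 + 1) j).
  rewrite dE; apply/funext => j; rewrite /pseries_diffs mulrCA -mulrA; congr (_ * _).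
  exact: (congr1 (fun f => f j) (pseries_diffs_prabhakar_coef b1)).
have -> : b * prabhakar_sum (b + 1) z = limn (pseries (pseries_diffs (prabhakar_coef b)) z).
  rewrite dE; apply/esym/cvg_lim; first exact: norm_hausdorff.
  by apply: cvg_pseriesZ; exact: cvg_prabhakar_sum.
apply: (@pseries_snd_diffs _ _ (`|z| + 1)).
- exact: cvg_prabhakar_sum.
- by rewrite dE; exact: cvgZ.
- by rewrite ddE; exact: cvgZ.
- exact: zK.
Qed.

Definition prabhakar_kernel b t : R :=
  t `^ (alpha * b - 1) * prabhakar_sum b (- (t `^ alpha)).

Lemma hn_kernelE b t : 0 < b -> hn_kernel alpha b t = prabhakar_kernel b t.
Proof.
move=> b0; rewrite /hn_kernel /prabhakar_kernel; congr (_ * _).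
rewrite /prabhakar; set z := - (t `^ alpha).
rewrite (_ : limn _ = Gamma b * prabhakar_sum b z).
  by rewrite mulKf// gt_eqF// Gamma_gt0.
apply: cvg_lim => //.
have := @cvg_pseriesZ (Gamma b) _ _ _ (@cvg_prabhakar_sum b z b0).
rewrite (_ : pseries _ _ = series (fun k : nat =>
    Gamma (k%:R + b) / Gamma (alpha * k%:R + alpha * b) * (z ^+ k / k`!%:R)))//.
apply/funext => n; rewrite /pseries /series/=; apply: eq_bigr => j _.
rewrite /prabhakar_coef /negbin.
have := lt0r_neq0 (Gamma_gt0 b0); have := lt0r_neq0 (Gamma_gt0 (order_gt0 j b0)).
have : j`!%:R != 0 :> R by rewrite pnatr_eq0 -lt0n fact_gt0.
move: (Gamma b) (Gamma (j%:R + b)) (Gamma (_ + _)) (j`!%:R) (z ^+ j) => g1 g2 g3 f w f0 g30 g10.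
by field; rewrite f0 g30 g10.
Qed.

(** With K_b(s) = (1 + s^alpha)^(- b), this is the inverse Laplace transform of
d/ds (s K_b) = (1 - alpha b) K_b + alpha b K_(b + 1), here checked on the power
series, whose derivative is again one with b + 1 in place of b. *)
Lemma is_derive_prabhakar_kernel b t : 0 < b -> 0 < t ->
  is_derive t (1 : R) (prabhakar_kernel b)
    (- ((1 - alpha * b) * prabhakar_kernel b t
        + alpha * b * prabhakar_kernel (b + 1) t) / t).
Proof.
move=> b0 t0.
have h1 := is_derive1_powR (alpha * b - 1) t0.
have h2 := is_derive1_powR alpha t0.
have h3 := is_derive_prabhakar_sum (- (t `^ alpha)) b0.
have h4 : is_derive t (1 : R) (fun t => prabhakar_sum b (- (t `^ alpha)))
    (b * prabhakar_sum (b + 1) (- (t `^ alpha)) * - (alpha * t `^ (alpha - 1))).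
  apply: (is_derive1_comp (f := prabhakar_sum b) (g := fun t => - (t `^ alpha))).
have h5 := is_deriveM h1 h4.
rewrite /prabhakar_kernel; apply: (is_derive_eq h5); rewrite /GRing.scale/=.
have -> : t `^ (alpha * b - 1 - 1) = t `^ (alpha * b - 1) / t.
  by rewrite powRD_gt0// powR_inv1// ltW.
have -> : t `^ (alpha * (b + 1) - 1) = t `^ (alpha * b - 1) * t `^ (alpha - 1) * t.
  rewrite (_ : _ - 1 = (alpha * b - 1) + (alpha - 1) + 1); last ring.
  by rewrite [LHS]powRD_gt0// powRr1 ?(ltW t0)// [X in X * _]powRD_gt0.
move: (t `^ (alpha * b - 1)) (t `^ (alpha - 1)) (prabhakar_sum b _) (prabhakar_sum _ _).
move: (gt_eqF t0) => t_neq0 x q S0 S1.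
by field; rewrite t_neq0.
Qed.

Lemma continuous_prabhakar_kernel b t : 0 < b -> 0 < t ->
  {for t, continuous (prabhakar_kernel b)}.
Proof.
move=> b0 t0; apply/differentiable_continuous/derivable1_diffP.
by have [] := is_derive_prabhakar_kernel b0 t0.
Qed.

(** The integral is (-1)^n times the n-th derivative of (1 + s^alpha)^(- b). The
bound 1 < s is where the expansion in powers of s^(- alpha) converges. *)
Lemma laplace_prabhakar_kernel b s n : 0 < b -> 1 < s ->
  mu.-integrable pos (EFin \o (fun t => prabhakar_kernel b t * (t ^+ n * expR (- (s * t))))) /\
  0 <= \int[mu]_(t in pos) (prabhakar_kernel b t * (t ^+ n * expR (- (s * t)))).
Proof.
move=> b0 s1; have s0 : 0 < s by exact: lt_trans s1.
have N1 : `|- 1 : R| <= 1 by rewrite normrN normr1.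
have [|intF cvgF] := integral_series mpos (fun j => @integrable_term b s n (-1) j b0 s0)
  (@cvg_abs_term b s n (-1) b0 s1 N1)
  (F := fun t => prabhakar_kernel b t * (t ^+ n * expR (- (s * t)))).
  move=> t; rewrite /= in_itv/= andbT => t0.
  rewrite (_ : series _ = (fun m => pseries (prabhakar_coef b) (- (t `^ alpha)) m
     * (t `^ (alpha * b - 1) * (t ^+ n * expR (- (s * t)))))).
    rewrite /prabhakar_kernel -[X in _ --> X]mulrA [X in _ --> X]mulrCA.
    by apply: cvgM; [exact: cvg_prabhakar_sum|exact: cvg_cst].
  apply/funext => m; rewrite /pseries /series/= mulr_suml; apply: eq_bigr => j _.
  by rewrite termE// mulN1r.
split => //; have [l l0 hl] := @sum_term b s n (-1) b0 s1 N1.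
by rewrite (cvg_unique _ cvgF hl).
Qed.

End HavriliakNegamiKernel.

(** * Positivity from the Laplace transform *)

Section LaplacePositivity.
Variable R : realType.
Local Notation mu := (@lebesgue_measure R).
Local Notation pos := (`]0%R, +oo[%classic : set (measurableTypeR R)).
Implicit Types t y : R.

(** The profile of t exp (- t / t0) in the variable y = t / t0, normalized to have
its maximum 1 at y = 1. *)
Let bump y : R := y * expR (1 - y).

Let bump_ge0 y : 0 <= y -> 0 <= bump y.
Proof. by move=> y0; rewrite mulr_ge0 ?expR_ge0. Qed.

Let bump1 : bump 1 = 1.
Proof. by rewrite /bump subrr expR0 mulr1. Qed.

Let bump_lt1 y : y != 1 -> bump y < 1.
Proof.
move=> y1; rewrite /bump -opprB expRN -[ltRHS](mulfV (lt0r_neq0 (expR_gt0 (y - 1)))).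
rewrite ltr_pM2r ?invr_gt0 ?expR_gt0//.
have := @expR_gt1Dx R (y - 1); rewrite subr_eq0 addrC subrK; exact.
Qed.

(** Monotonicity on either side of 1, in one statement: y' lies between y and 1.
It follows from y / y' <= exp (y / y' - 1). *)
Let bump_le y y' : 0 < y' -> (y - y') * (1 - y') <= 0 -> bump y <= bump y'.
Proof.
move=> y0 h; rewrite /bump.
have h1 : y <= y' * expR ((y - y') / y').
  rewrite -ler_pdivrMl//; apply: le_trans (expR_ge1Dx _).
  by rewrite mulrBl mulfV ?gt_eqF// addrC subrK mulrC.
apply: (@le_trans _ _ (y' * expR ((y - y') / y') * expR (1 - y))).
  by rewrite ler_wpM2r ?expR_ge0.
rewrite -mulrA -expRD ler_wpM2l ?(ltW y0)// ler_expR.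
rewrite -subr_le0 (_ : _ - _ = (y - y') * (1 - y') / y'); last by field; rewrite gt_eqF.
by rewrite pmulr_lle0// invr_gt0.
Qed.

Let continuous_bump : continuous bump.
Proof.
move=> y; apply: (@cvgM _ R); first exact: cvg_id.
apply: continuous_comp; last exact: continuous_expR.
by apply: (@cvgB _ R); [exact: cvg_cst|exact: cvg_id].
Qed.

(** The weights t^n exp (- n t / t0), normalized to have maximum 1, concentrate at
t0 as n grows: if k(t0) < 0, the integrals against them end up negative, because
the weights are at most r0^n away from t0 and at least r1^n near t0, for some
r0 < r1. *)
Lemma ge0_of_laplace_moments (k : R -> R) :
  (forall t, 0 < t -> {for t, continuous k}) ->
  (forall n s, 1 < s ->
    mu.-integrable pos (EFin \o (fun t => k t * (t ^+ n * expR (- (s * t))))) /\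
    0 <= \int[mu]_(t in pos) (k t * (t ^+ n * expR (- (s * t))))) ->
  forall t, 0 < t -> 0 <= k t.
Proof.
move=> ck hk t0 t0_gt0; rewrite leNgt; apply/negP => kt0.
pose c := - k t0 / 2; have c0 : 0 < c by rewrite /c; lra.
have [d [d0 d1 hd]] : exists d : R, [/\ 0 < d, d < 1 &
    forall t, `|t / t0 - 1| <= d -> k t <= - c].
  have /cvgrPdist_lt /(_ c c0) := ck _ t0_gt0.
  rewrite nearE => /nbhs_ballP[e /= e0 he].
  exists (Num.min (1 / 2) (e / (2 * t0))); split.
  - by rewrite lt_min divr_gt0// divr_gt0// mulr_gt0.
  - by rewrite gt_min; apply/orP; left; lra.
  move=> t ht.
  have te : `|t0 - t| < e.
    have : `|t / t0 - 1| * t0 <= e / (2 * t0) * t0.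
      by rewrite ler_wpM2r ?(ltW t0_gt0)// (le_trans ht)// ge_min lexx orbT.
    rewrite (_ : `|_| * t0 = `|t0 - t|); last first.
      rewrite distrC -[X in _ * X](gtr0_norm t0_gt0) -normrM; congr `|_|.
      by field; rewrite gt_eqF.
    rewrite (_ : e / (2 * t0) * t0 = e / 2); last by field; rewrite gt_eqF.
    by lra.
  have := he t te; rewrite /= ltr_norml => /andP[h1 h2].
  by rewrite /c in h1 h2 *; lra.
pose r0 := Num.max (bump (1 - d)) (bump (1 + d)).
have r0_lt1 : r0 < 1 by rewrite gt_max !bump_lt1//; apply/eqP; lra.
have r0_ge0 : 0 <= r0 by rewrite le_max bump_ge0//; lra.
have r0_out y : 0 < y -> d <= `|y - 1| -> bump y <= r0.
  move=> y0; rewrite ler_normr => /orP[h|h].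
    rewrite le_max; apply/orP; right; apply: bump_le; first by lra.
    by rewrite mulr_ge0_le0//; lra.
  rewrite le_max; apply/orP; left; apply: bump_le; first by lra.
  by rewrite mulr_le0_ge0//; lra.
pose r1 := (1 + r0) / 2.
have r1_gt0 : 0 < r1 by rewrite /r1; lra.
have r01 : r0 < r1 by rewrite /r1; lra.
have [d' [d'0 d'd hd']] : exists d' : R, [/\ 0 < d', d' <= d &
    forall y, `|y - 1| <= d' -> r1 <= bump y].
  have r11 : 0 < 1 - r1 by rewrite /r1; lra.
  have /cvgrPdist_lt /(_ _ r11) := @continuous_bump 1.
  rewrite nearE => /nbhs_ballP[e /= e0 he].
  exists (Num.min d (e / 2)); split.
  - by rewrite lt_min d0 divr_gt0.
  - by rewrite ge_min lexx.
  move=> y hy.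
  have ye : `|1 - y| < e.
    have : `|y - 1| <= e / 2 by rewrite (le_trans hy)// ge_min lexx orbT.
    by rewrite distrC; lra.
  have := he y ye; rewrite /= bump1 ltr_norml => /andP[h1 h2].
  by lra.
(* For n >= n0 the frequency n / t0 exceeds 1, where the moments are known. *)
pose n0 := (Num.trunc t0).+1.
have n0t : t0 < n0%:R by exact: truncnS_gt.
pose B t := bump (t / t0).
have BE n t : B t ^+ n = (expR 1 / t0) ^+ n * (t ^+ n * expR (- (n%:R / t0 * t))).
  rewrite /B /bump expRD !exprMn -!expRM_natl mulrN.
  by rewrite (_ : n%:R * (t / t0) = n%:R / t0 * t); [ring|ring].
have hB n : (n0 <= n)%N -> mu.-integrable pos (EFin \o (fun t => k t * B t ^+ n)) /\
    0 <= \int[mu]_(t in pos) (k t * B t ^+ n).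
  move=> n0n; have s1 : 1 < n%:R / t0.
    by rewrite ltr_pdivlMr// mul1r (lt_le_trans n0t)// ler_nat.
  have [i1 i2] := hk n _ s1.
  have -> : (fun t => k t * B t ^+ n) = (fun t => (expR 1 / t0) ^+ n * (k t * (t ^+ n * expR (- (n%:R / t0 * t))))).
    by apply/funext => t; rewrite BE; ring.
  have mpos : measurable pos by exact: measurable_itv.
  split; first exact: integrableZl mpos _ _ i1.
  rewrite RintegralZl// mulr_ge0// exprn_ge0// divr_ge0 ?expR_ge0//.
  exact: ltW.
pose w t := k t * B t ^+ n0.
have [iw _] := hB n0 (leqnn _).
have iw' : mu.-integrable pos (EFin \o (fun t => `|w t|)) by exact: integrable_norm.
have mpos : measurable pos by exact: measurable_itv.
pose U : set (measurableTypeR R) := `[t0 * (1 - d'), t0 * (1 + d')]%classic.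
have mU : measurable U by exact: measurable_itv.
have UE t : 0 < t -> U t <-> `|t / t0 - 1| <= d'.
  move=> _; rewrite /U/= in_itv/= ler_norml lerBrDl (lerBlDl (t / t0)).
  by rewrite ler_pdivlMr// ler_pdivrMr// mulrC [in X in _ <-> _ && X]mulrC.
have Upos : U `&` pos = U.
  apply/setIidl => t; rewrite /U/= !in_itv/= andbT => /andP[+ _].
  by apply: lt_le_trans; rewrite mulr_gt0//; lra.
pose L := t0 * (2 * d').
have L0 : 0 < L by rewrite mulr_gt0// mulr_gt0.
have muU : mu (U `&` pos) = L%:E.
  rewrite Upos lebesgue_measure_itv/= lte_fin ltr_pM2l// ifT; last by lra.
  by rewrite -EFinB; congr EFin; rewrite /L; ring.
have iU : mu.-integrable pos (EFin \o (\1_U : _ -> R)).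
  apply/integrableP; split; first exact/measurable_EFinP/measurable_funTS.
  under eq_integral => t _ do rewrite gee0_abs ?lee_fin//.
  by rewrite integral_indic//; apply: le_lt_trans (ltry L); rewrite le_eqVlt; apply/orP; left; apply/eqP; exact: muU.
have intU : \int[mu]_(t in pos) (\1_U t : R) = L.
  by rewrite /Rintegral integral_indic//; exact: (congr1 fine muU).
pose I := \int[mu]_(t in pos) `|w t|.
have key N : c * r1 ^+ n0 * L * r1 ^+ N <= I * r0 ^+ N.
  have [iN N_ge0] := hB (n0 + N)%N (leq_addr _ _).
  have i1 : mu.-integrable pos (EFin \o (fun t => r0 ^+ N * `|w t|)).
    exact: integrableZl mpos _ _ iw'.
  have i2 : mu.-integrable pos (EFin \o (fun t => (c * r1 ^+ (n0 + N)) * (\1_U : _ -> R) t)).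
    exact: integrableZl mpos _ _ iU.
  have : \int[mu]_(t in pos) (k t * B t ^+ (n0 + N)) <=
      \int[mu]_(t in pos) (r0 ^+ N * `|w t| - (c * r1 ^+ (n0 + N)) * (\1_U : _ -> R) t).
    have i3 := integrableB mpos i1 i2.
    apply: le_Rintegral => //.
    move=> t; rewrite /= in_itv/= andbT => t_gt0.
    have y0 : 0 < t / t0 by rewrite divr_gt0.
    have By : 0 <= B t by rewrite bump_ge0 ?ltW.
    rewrite indicE; have [tU|tU] := boolP (t \in U).
      have tU' := (UE _ t_gt0).1 (set_mem tU).
      have kt := hd t (le_trans tU' d'd).
      have r1B : r1 ^+ (n0 + N) <= B t ^+ (n0 + N).
        by rewrite lerXn2r ?nnegrE ?(ltW r1_gt0)// hd'.
      apply: (@le_trans _ _ (- (c * r1 ^+ (n0 + N)))).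
        have p1 : 0 <= r1 ^+ (n0 + N) by rewrite exprn_ge0 ?ltW.
        by nra.
      by rewrite mulr1 lerBrDr addNr mulr_ge0 ?exprn_ge0.
    rewrite mulr0 subr0 exprD mulrA -/(w t).
    have [td|td] := leP `|t / t0 - 1| d.
      apply: (@le_trans _ _ 0); last by rewrite mulr_ge0 ?exprn_ge0.
      rewrite mulr_le0_ge0 ?exprn_ge0// mulr_le0_ge0 ?exprn_ge0//.
      by rewrite (le_trans (hd t td))// oppr_le0 ltW.
    apply: (@le_trans _ _ (`|w t| * B t ^+ N)).
      by rewrite ler_wpM2r ?exprn_ge0// ler_norm.
    rewrite mulrC ler_wpM2r// lerXn2r ?nnegrE// r0_out//.
    exact: ltW.
  move/(le_trans N_ge0); rewrite RintegralB// RintegralZl// RintegralZl// intU subr_ge0.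
  rewrite -/I [leRHS]mulrC (_ : c * r1 ^+ n0 * L * r1 ^+ N = c * r1 ^+ (n0 + N) * L)//.
  by rewrite exprD; ring.
have lim0 : (I * (r0 / r1) ^+ N) @[N --> \oo] --> (0 : R).
  rewrite -[X in _ --> X](mulr0 I); apply: cvgM; first exact: cvg_cst.
  have q0 : 0 <= r0 / r1 by rewrite divr_ge0// ltW.
  by apply: cvg_expr; rewrite ger0_norm// ltr_pdivrMr// mul1r.
have C0 : 0 < c * r1 ^+ n0 * L by rewrite mulr_gt0// mulr_gt0// exprn_gt0.
suff : c * r1 ^+ n0 * L <= 0 by rewrite leNgt C0.
rewrite -(cvg_lim _ lim0)//; apply: limr_ge; first exact: cvgP lim0.
apply: nearW => N; rewrite (expr_div_n r0 r1) [leRHS]mulrA ler_pdivlMr ?exprn_gt0//.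
Qed.

End LaplacePositivity.

(** * The shape of the kernel *)

Section KernelShape.
Variables (R : realType) (alpha beta : R).
Hypotheses (alpha01 : 0 < alpha <= 1) (beta0 : 0 < beta).
Local Notation mu := (@lebesgue_measure R).
Local Notation pos := (`]0%R, +oo[%classic : set (measurableTypeR R)).

Lemma prabhakar_kernel_ge0 b t : 0 < b -> 0 < t ->
  0 <= prabhakar_kernel alpha b t.
Proof.
move=> b0; apply: (ge0_of_laplace_moments (k := prabhakar_kernel alpha b)).
  by move=> x x0; exact: continuous_prabhakar_kernel.
by move=> n s s1; exact: laplace_prabhakar_kernel.
Qed.

Lemma hn_kernel_ge0 t : 0 < t -> 0 <= hn_kernel alpha beta t.
Proof. by move=> t0; rewrite hn_kernelE// prabhakar_kernel_ge0. Qed.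

Lemma hn_kernel_nincr s t : beta <= 1 -> 0 < s -> s <= t ->
  hn_kernel alpha beta t <= hn_kernel alpha beta s.
Proof.
move=> beta1 s0 st; rewrite (hn_kernelE alpha01 s beta0) (hn_kernelE alpha01 t beta0).
have dk x : x \in `]s, t[ -> is_derive x (1 : R) (prabhakar_kernel alpha beta)
    (- ((1 - alpha * beta) * prabhakar_kernel alpha beta x
        + alpha * beta * prabhakar_kernel alpha (beta + 1) x) / x).
  rewrite in_itv/= => /andP[sx _].
  by apply: is_derive_prabhakar_kernel => //; exact: lt_trans sx.
case/andP: (alpha01) => alpha0 alpha1.
apply: (ler0_derive1_nincr _ _ _ (lexx s) st (lexx t)).
- by move=> x /dk[].
- move=> x xst; have x0 : 0 < x.
    by move: xst; rewrite in_itv/= => /andP[sx _]; exact: lt_trans sx.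
  have [_ d] := dk x xst; rewrite derive1E d mulNr oppr_le0 divr_ge0 ?(ltW x0)//.
  have k1 := prabhakar_kernel_ge0 beta0 x0.
  have k2 := prabhakar_kernel_ge0 (addr_gt0 beta0 ltr01) x0.
  have ab0 : 0 <= alpha * beta by rewrite mulr_ge0// ltW.
  have ab1 : 0 <= 1 - alpha * beta by rewrite subr_ge0 mulr_ile1// ltW.
  exact: addr_ge0 (mulr_ge0 ab1 k1) (mulr_ge0 ab0 k2).
- apply: continuous_in_subspaceT => x; rewrite inE/= in_itv/= => /andP[sx _].
  by apply: continuous_prabhakar_kernel => //; exact: lt_le_trans sx.
Qed.

(** The kernel is integrable against exp (- 2 t), which is bounded below on the
interval. *)
Lemma integrable_hn_kernel T :
  mu.-integrable `[0, T] (EFin \o hn_kernel alpha beta).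
Proof.
have s1 : (1 : R) < 2 by rewrite ltr1n.
have mpos : measurable pos by exact: measurable_itv.
have [i1 _] := laplace_prabhakar_kernel alpha01 0 beta0 s1.
pose D : set (measurableTypeR R) := `]0, T]%classic.
have mD : measurable D by exact: measurable_itv.
have Dpos : D `<=` pos.
  by move=> t /=; rewrite !in_itv/= andbT => /andP[].
have mk : measurable_fun pos (hn_kernel alpha beta).
  apply: (eq_measurable_fun (prabhakar_kernel alpha beta)).
    by move=> t _; rewrite hn_kernelE.
  apply: open_continuous_measurable_fun; first exact: interval_open.
  move=> t; rewrite inE/= in_itv/= andbT => t0.
  exact: continuous_prabhakar_kernel.
have i2 : mu.-integrable D (EFin \o (fun t => expR (2 * T) *
    (prabhakar_kernel alpha beta t * (t ^+ 0 * expR (- (2 * t)))))).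
  exact: integrableZl mD _ _ (integrableS mpos mD Dpos i1).
have i3 : mu.-integrable D (EFin \o hn_kernel alpha beta).
  apply: le_integrable i2 => //.
    by apply/measurable_EFinP; exact: measurable_funS mk.
  move=> t; rewrite /D/= in_itv/= => /andP[t0 tT]; rewrite lee_fin hn_kernelE//.
  move: (prabhakar_kernel alpha beta t) => k.
  rewrite expr0 mul1r mulrCA normrM ler_peMr// -expRD ger0_norm ?expR_ge0//.
  by rewrite -[leLHS]expR0 ler_expR; lra.
case/integrableP: i3 => m3 i3; apply/integrableP.
have m3' : measurable_fun `[0, T] (EFin \o hn_kernel alpha beta).
  by apply/measurable_EFinP/measurable_fun_itv_obnd_cbndP/measurable_EFinP.
split => //; rewrite -integral_itv_obnd_cbnd//.
by apply: measurableT_comp.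
Qed.

End KernelShape.

(** * Monotonicity from a Dini derivative *)

Section DiniMonotonicity.
Variable R : realType.

(** The first hypothesis says that the upper left Dini derivative is nonpositive,
the second that G is upper semicontinuous from the right. If G b > G a, subtract
a linear function of small slope e, and let s0 be the infimum of the points where
the difference f is at least f b: s0 itself belongs to that set by semicontinuity, but then f is
at least as large just before s0. *)
Lemma dini_nonincreasing (G : R -> R) (a b : R) : a <= b ->
  (forall t : R, a < t <= b -> forall e : R, 0 < e -> exists2 d : R, 0 < d &
    forall h : R, 0 < h < d -> a <= t - h -> G t - G (t - h) <= e * h) ->
  (forall t : R, a <= t < b -> forall e : R, 0 < e -> exists2 d : R, 0 < d &
    forall s : R, t < s < t + d -> s <= b -> G s <= G t + e) ->
  G b <= G a.
Proof.
move=> ab left_dini right_usc; rewrite leNgt; apply/negP => Gab.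
have {}ab : a < b.
  by rewrite lt_neqAle ab andbT; apply: contraTneq Gab => ->; rewrite ltxx.
have ba : 0 < b - a by rewrite subr_gt0.
pose e := (G b - G a) / (2 * (b - a)).
have e0 : 0 < e by rewrite divr_gt0 ?subr_gt0// mulr_gt0.
pose f s := G s - e * (s - a).
have fab : f a < f b.
  rewrite /f subrr mulr0 subr0.
  have -> : e * (b - a) = (G b - G a) / 2 by rewrite /e; field; rewrite gt_eqF.
  by lra.
pose A : set R := [set s | a <= s <= b /\ f b <= f s].
have Ab : A b by rewrite /A/= lexx (ltW ab).
have lbA : has_lbound A by exists a => s [/andP[]].
have infA : has_inf A by split => //; exists b.
pose s0 := inf A.
have s0_le s : A s -> s0 <= s by move=> As; apply: ge_inf.
have as0 : a <= s0 by apply: lb_le_inf; [exists b|move=> s [/andP[]]].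
have s0b : s0 <= b by exact: s0_le.
have As0 : A s0.
  split; first by rewrite as0.
  rewrite leNgt; apply/negP => fs0.
  have s0b' : s0 < b by rewrite lt_neqAle s0b andbT; apply: contraTneq fs0 => ->; rewrite ltxx.
  have e1 : 0 < (f b - f s0) / 2 by rewrite divr_gt0// subr_gt0.
  have [|d d0 hd] := right_usc s0 _ _ e1; first by rewrite as0.
  have [s As sd] := inf_adherent d0 infA.
  have s0s : s0 < s.
    rewrite lt_neqAle s0_le// andbT; apply: contraTneq As.2 => <-.
    by rewrite -ltNge.
  have := hd s; rewrite s0s sd => /(_ isT).
  case: As => [/andP[as_ sb] fs] /(_ sb).
  have es : e * (s0 - a) <= e * (s - a) by rewrite ler_wpM2l ?(ltW e0)// lerD2r ltW.
  rewrite /f in fs fs0 * => Gs; lra.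
have as0' : a < s0.
  rewrite lt_neqAle as0 andbT; apply: contraTneq fab => ->.
  by rewrite -leNgt; case: As0.
have [|d d0 hd] := left_dini s0 _ _ e0; first by rewrite as0' s0b.
pose h := Num.min (d / 2) (s0 - a).
have h0 : 0 < h by rewrite lt_min divr_gt0//= subr_gt0.
have hd' : h < d by rewrite gt_min; apply/orP; left; lra.
have ha : a <= s0 - h by rewrite lerBrDr -lerBrDl ge_min lexx orbT.
have := hd h; rewrite h0 hd' => /(_ isT ha) Gh.
have : A (s0 - h).
  split; first by rewrite ha lerBlDr (le_trans s0b)// lerDl ltW.
  apply: (le_trans As0.2); rewrite /f.
  have -> : e * (s0 - h - a) = e * (s0 - a) - e * h by ring.
  by lra.
by move/s0_le; rewrite lerBrDl gerDr leNgt h0.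
Qed.

End DiniMonotonicity.

(** * Convolution with a nonincreasing kernel *)

Section Convolution.
Variables (R : realType) (k : R -> R) (T : R).
Local Notation mu := (@lebesgue_measure R).
Hypothesis k_ge0 : forall t : R, 0 < t -> 0 <= k t.
Hypothesis k_nincr : forall s t : R, 0 < s -> s <= t -> k t <= k s.
Hypothesis k_int : mu.-integrable `[0, T] (EFin \o k).

Definition mass h : R := \int[mu]_(s in `[0, h]) k s.

Definition memory (f : R -> R) t : R := \int[mu]_(s in `[0, t]) (k (t - s) * f s).

Lemma mass_cvg0 : 0 < T -> mass h @[h --> 0] --> (0 : R).
Proof. by move=> T0; exact: parameterized_integral_cvg_left k_int. Qed.

Let itvS a b : 0 <= a -> b <= T ->
  (`]a, b[%classic : set (measurableTypeR R)) `<=` `[0, T]%classic.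
Proof.
move=> a0 bT t /=; rewrite !in_itv/= => /andP[h1 h2].
by rewrite (le_trans a0 (ltW h1)) (le_trans (ltW h2)).
Qed.

Let k_intS b : b <= T -> mu.-integrable `]0, b[ (EFin \o k).
Proof.
move=> bT; apply: integrableS k_int => //; exact: itvS.
Qed.

(** The endpoints are left out because the sign of the kernel is only known on
(0, +oo). *)
Let reflect_ooE a t : (fun x => t - x) @^-1` `]0, t - a[ = `]a, t[%classic :> set R.
Proof.
apply/seteqP; split => x /=; rewrite !in_itv/= => /andP[h1 h2]; lra.
Qed.

Lemma integrable_reflected_kernel a t : 0 <= a -> t <= T ->
  mu.-integrable `]a, t[ (EFin \o (fun s => k (t - s))).
Proof.
move=> a0 tT; have /integrableP[mk ik] : mu.-integrable `]0, t - a[ (EFin \o k).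
  by apply: k_intS; lra.
have mphi : measurable_fun [set: measurableTypeR R]
    ((fun x => t - x) : measurableTypeR R -> measurableTypeR R).
  exact: measurable_funB.
apply/integrableP; split.
  rewrite -reflect_ooE.
  apply: (measurable_comp (F := `]0, t - a[%classic)) mk _ => //.
    by move=> _ [x + <-].
  exact: measurable_funTS.
move: ik; rewrite (integral_reflection t)//.
- by rewrite reflect_ooE.
- by apply: measurableT_comp.
Qed.

Let Rintegral_oo (a b : R) (b0 b1 : bool) (f : R -> R) :
  measurable_fun `]a, b[ f ->
  \int[mu]_(s in [set` Interval (BSide b0 a) (BSide b1 b)]) f s
  = \int[mu]_(s in `]a, b[) f s.
Proof.
by move=> mf; rewrite /Rintegral integral_itv_bndoo//; exact/measurable_EFinP.
Qed.

Let massE h : h <= T -> mass h = \int[mu]_(s in `]0, h[) k s.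
Proof.
move=> hT; rewrite /mass Rintegral_oo//; apply/measurable_EFinP.
exact: measurable_int (k_intS hT).
Qed.

Lemma mass_ge0 h : h <= T -> 0 <= mass h.
Proof.
move=> hT; rewrite massE//; apply: Rintegral_ge0 => s.
by rewrite /= in_itv/= => /andP[s0 _]; exact: k_ge0.
Qed.

Lemma Rintegral_reflected_kernel a t : 0 <= a -> t <= T ->
  \int[mu]_(s in `]a, t[) k (t - s) = mass (t - a).
Proof.
move=> a0 tT; have tT' : t - a <= T by lra.
rewrite massE// /Rintegral; congr fine.
rewrite [RHS](integral_reflection t)//.
- by rewrite reflect_ooE.
- exact: measurable_int (k_intS tT').
- by move=> s; rewrite inE/= in_itv/= => /andP[s0 _]; rewrite lee_fin k_ge0.
Qed.

Definition admissible (f : R -> R) (t : R) :=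
  measurable_fun (`]0, t[ : set R) f /\ exists M : R, forall s : R, s \in `]0, t[ -> `|f s| <= M.

Lemma integrable_memory f t : t <= T -> admissible f t ->
  mu.-integrable `]0, t[ (EFin \o (fun s => k (t - s) * f s)).
Proof.
move=> tT [mf [M fM]].
have mD : measurable (`]0, t[%classic : set (measurableTypeR R)) by exact: measurable_itv.
have i := integrable_reflected_kernel (lexx 0) tT.
apply: (integrableMl mD i mf).
exists M; split; first exact: num_real.
by move=> N MN s /= sD; rewrite (le_trans (fM s _))// ltW.
Qed.

Let memoryE f t : t <= T -> admissible f t ->
  memory f t = \int[mu]_(s in `]0, t[) (k (t - s) * f s).
Proof.
move=> tT adm; rewrite /memory Rintegral_oo//; apply/measurable_EFinP.
exact: measurable_int (integrable_memory tT adm).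
Qed.

Lemma memory_quadratic e a c t : t <= T -> admissible e t -> admissible a t ->
  memory (fun s => e s - 2 * a s + c) t = memory e t - 2 * memory a t + c * mass t.
Proof.
move=> tT adme adma.
have mD : measurable (`]0, t[%classic : set (measurableTypeR R)) by exact: measurable_itv.
have ie := integrable_memory tT adme; have ia := integrable_memory tT adma.
have ik := integrable_reflected_kernel (lexx 0) tT.
have ia2 : mu.-integrable `]0, t[ (EFin \o (fun s => 2 * (k (t - s) * a s))).
  exact: integrableZl mD _ _ ia.
have ikc : mu.-integrable `]0, t[ (EFin \o (fun s => c * k (t - s))).
  exact: integrableZl mD _ _ ik.
have iea : mu.-integrable `]0, t[ (EFin \o (fun s => k (t - s) * e s - 2 * (k (t - s) * a s))).
  by apply: (eq_integrable mD _ _ _ (integrableB mD ie ia2)).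
rewrite [LHS]Rintegral_oo; last first.
  have := measurable_int _ (integrableD mD iea ikc).
  move/measurable_EFinP; apply: eq_measurable_fun => s _ /=; ring.
rewrite !memoryE// -[X in mass X]subr0 -Rintegral_reflected_kernel//.
rewrite -RintegralZl// -RintegralB// -RintegralZl// -RintegralD//.
by apply: eq_Rintegral => s _; ring.
Qed.

(** From time r to time t the values of d before r lose weight, as the kernel is
nonincreasing; only those after r can add to the convolution. *)
Lemma memory_step d M r t : 0 <= r -> r < t -> t <= T -> admissible d t ->
  (forall s : R, s \in `]0, t[ -> 0 <= d s) ->
  (forall s : R, s \in `]r, t[ -> d s <= M) ->
  memory d t <= memory d r + M * mass (t - r).
Proof.
move=> r0 rt tT adm d0 dM.
have rT : r <= T by lra.
have sub_rt : (`]0, r[%classic : set (measurableTypeR R)) `<=` `]0, t[%classic.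
  by move=> s /=; rewrite !in_itv/= => /andP[-> ]; lra.
have sub_rt' : (`]r, t[%classic : set (measurableTypeR R)) `<=` `]0, t[%classic.
  by move=> s /=; rewrite !in_itv/=; lra.
have admr : admissible d r.
  case: adm => mf [N fN]; split; first exact: measurable_funS mf.
  by exists N => s sr; apply: fN; apply: sub_rt.
have it := integrable_memory tT adm; have ir := integrable_memory rT admr.
rewrite [memory d t]memoryE// [memory d r]memoryE//.
have := Rintegral_itvB it (a := BRight 0) (b := BLeft t) (x := r).
rewrite !bnd_simp => /(_ r0 rt) /eqP; rewrite subr_eq => /eqP ->.
rewrite addrC lerD//.
  rewrite Rintegral_oo; last first.
    by apply/measurable_EFinP; apply: measurable_int (integrableS _ _ sub_rt it).
  apply: le_Rintegral => //; first exact: (integrableS _ _ sub_rt it).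
  move=> s; rewrite /= in_itv/= => /andP[s0 sr].
  rewrite ler_wpM2r//; first by rewrite d0// in_itv/= s0; lra.
  by apply: k_nincr; lra.
have mD : measurable (`]r, t[%classic : set (measurableTypeR R)) by exact: measurable_itv.
have ik := integrable_reflected_kernel r0 tT.
rewrite -Rintegral_reflected_kernel// -RintegralZl//.
apply: le_Rintegral => //.
- exact: (integrableS _ _ sub_rt' it).
- exact: integrableZl mD _ _ ik.
move=> s sD; rewrite mulrC ler_wpM2r ?dM//.
by apply: k_ge0; move: sD; rewrite /= in_itv/= => /andP[_]; rewrite subr_gt0.
Qed.

Lemma mass_le r t : 0 <= r -> r <= t -> t <= T -> mass r <= mass t.
Proof.
move=> r0 rt tT; have t0 : 0 <= t by lra.
have it : mu.-integrable `[0, t] (EFin \o k).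
  by apply: integrableS k_int => // s /=; rewrite !in_itv/=; lra.
rewrite -subr_ge0 /mass (Rintegral_itvB it) ?bnd_simp//.
apply: Rintegral_ge0 => s; rewrite /= in_itv/= => /andP[rs _].
by apply: k_ge0; lra.
Qed.

Lemma continuous_admissible f t : 0 <= T -> t <= T ->
  {within `[0, T], continuous f} -> admissible f t.
Proof.
move=> T0 tT cf; split.
  have : measurable_fun (`[0, T] : set R) f.
    by apply: subspace_continuous_measurable_fun => //; exact: measurable_itv.
  apply: measurable_funS => // s /=; rewrite !in_itv/=; lra.
have [c1 _ h1] := EVT_max T0 cf; have [c2 _ h2] := EVT_min T0 cf.
exists (Num.max (f c1) (- f c2)) => s; rewrite in_itv/= => s0t.
have sT : s \in `[0, T] by rewrite in_itv/=; lra.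
by rewrite ler_norml lerNl !le_max lerN2 h2 ?orbT// h1.
Qed.

(** The dissipation argument on scalars: a t s stands for (E s, E t), so that
e s - 2 a t s + e t is the square of the norm of E s - E t, and B t s for
eps_inf (E s, E t) + (H s, H t). The function memory e may fail to be
differentiable; its left increments are compared with those of memory (a t)
through [memory_step], applied to the square of the norm. *)
Lemma memory_energy_nonincreasing (A e : R -> R) (a B : R -> R -> R) (c : R) :
  0 < T -> 0 <= c ->
  {within `[0, T], continuous A} -> {within `[0, T], continuous e} ->
  (forall t : R, t \in `[0, T] -> 0 <= e t) ->
  (forall t : R, t \in `]0, T] -> {within `[0, T], continuous a t}) ->
  (forall t s : R, t \in `]0, T] -> s \in `[0, T] -> 0 <= e s - 2 * a t s + e t) ->
  (forall t : R, t \in `]0, T] -> exists C : R, exists2 d : R, 0 < d &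
    forall s : R, s \in `[0, T] -> t - d < s < t -> e s - 2 * a t s + e t <= C * (t - s) ^+ 2) ->
  (forall t s : R, t \in `]0, T] -> s \in `[0, T] -> A t - A s <= 2 * (B t t - B t s)) ->
  (forall t : R, t \in `]0, T] -> forall r, 0 < r -> exists2 d, 0 < d &
    forall h, 0 < h < d -> 0 < t - h ->
      (B t t + c * memory (a t) t) - (B t (t - h) + c * memory (a t) (t - h)) <= r * h) ->
  forall t1 t2 : R, t1 \in `[0, T] -> t2 \in `[0, T] -> t2 <= t1 ->
    A t1 + c * memory e t1 <= A t2 + c * memory e t2.
Proof.
move=> T_gt0 c0 cA ce e0 ca d_ge0 d_le AB dB t1 t2 t1T t2T t21.
have T0 := ltW T_gt0; move: t1T t2T; rewrite !in_itv/= => /andP[_ t1T] /andP[t20 _].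
apply: (@dini_nonincreasing _ (fun t => A t + c * memory e t) t2 t1 t21).
- move=> t tt r r0; have t0 : 0 < t by lra.
  have tT : t <= T by lra.
  have tin : t \in `]0, T] by rewrite in_itv/= t0.
  have r40 : 0 < r / 4 by rewrite divr_gt0.
  have [d1 d10 hd1] := dB t tin _ r40.
  have [C [d2 d20 hd2]] := d_le t tin.
  have C0 : 0 <= `|C| by [].
  pose m := c * `|C| * mass T.
  have m0 : 0 <= m by rewrite mulr_ge0 ?mulr_ge0// mass_ge0.
  exists (Num.min (Num.min d1 d2) (Num.min t (r / (2 * (m + 1))))).
    by rewrite !lt_min d10 d20 t0 divr_gt0// mulr_gt0//; lra.
  move=> h; rewrite !lt_min => /andP[h0 /andP[/andP[hd1' hd2'] /andP[ht hr]]] _.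
  have th0 : 0 < t - h by rewrite subr_gt0.
  have thT : t - h \in `[0, T] by rewrite in_itv/= (ltW th0) (le_trans _ tT)// gerBl ltW.
  have hB := hd1 h; rewrite h0 hd1' th0 in hB; move: (hB isT isT) => {}hB.
  have hA := AB t _ tin thT.
  have adme s : s <= T -> admissible e s by move=> ?; exact: continuous_admissible.
  have adma s : s <= T -> admissible (a t) s by move=> ?; exact: continuous_admissible (ca t tin).
  have memory_sqE s : s <= T -> memory (fun x => e x - 2 * a t x + e t) s
      = memory e s - 2 * memory (a t) s + e t * mass s.
    by move=> sT; apply: memory_quadratic; [|exact: adme|exact: adma].
  have cd : {within `[0, T], continuous (fun x => e x - 2 * a t x + e t)}.
    move=> x; apply: cvgD; last exact: cvg_cst.
    apply: cvgB; first exact: ce.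
    by apply: cvgM; [exact: cvg_cst|exact: ca].
  have step : memory (fun x => e x - 2 * a t x + e t) t <=
      memory (fun x => e x - 2 * a t x + e t) (t - h) + (`|C| * h ^+ 2) * mass (t - (t - h)).
    apply: memory_step; [exact: ltW|by rewrite ltrBlDr ltrDl|exact: tT
      |exact: continuous_admissible| |].
      move=> s; rewrite in_itv/= => /andP[s0 st]; apply: d_ge0; first exact: tin.
      by rewrite in_itv/= (ltW s0) (le_trans (ltW st)).
    move=> s; rewrite in_itv/= => /andP[hs st].
    apply: (@le_trans _ _ (C * (t - s) ^+ 2)).
      apply: hd2.
        by rewrite in_itv/= (le_trans (ltW th0) (ltW hs)) (le_trans (ltW st)).
      by rewrite st andbT (lt_trans _ hs)// ltrD2l ltrN2.
    apply: (@le_trans _ _ (`|C| * (t - s) ^+ 2)).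
      by rewrite ler_wpM2r ?sqr_ge0// ler_norm.
    have ts0 : 0 <= t - s by rewrite subr_ge0 ltW.
    have tsh : t - s <= h by rewrite lerBlDr -lerBlDl ltW.
    by rewrite ler_wpM2l// lerXn2r// nnegrE ltW.
  move: step; rewrite !memory_sqE//; last lra.
  rewrite (_ : t - (t - h) = h); last ring.
  have mth : mass (t - h) <= mass t by apply: mass_le; rewrite ?(ltW th0)// gerBl ltW.
  have mhT : mass h <= mass T 
    by apply: mass_le; [exact: ltW|exact: le_trans (ltW ht) tT|].
  move: hB hA; set p1 := memory (a t) t; set p0 := memory (a t) (t - h).
  set F1 := memory e t; set F0 := memory e (t - h).
  move: (A t) (A (t - h)) (B t t) (B t (t - h)) => A1 A0 B1 B0 hB hA step.
  have et : 0 <= e t * (mass t - mass (t - h)).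
    by apply: mulr_ge0; [apply: e0; rewrite in_itv/= (ltW t0)|rewrite subr_ge0].
  have Cm : `|C| * h ^+ 2 * mass h <= `|C| * h ^+ 2 * mass T.
    by rewrite ler_wpM2l// mulr_ge0// sqr_ge0.
  have X : F1 - F0 <= 2 * (p1 - p0) + `|C| * h ^+ 2 * mass T by lra.
  have cX : c * (F1 - F0) <= c * (2 * (p1 - p0) + `|C| * h ^+ 2 * mass T).
    by rewrite ler_wpM2l.
  have mh : c * (`|C| * h ^+ 2 * mass T) <= r / 2 * h.
    have -> : c * (`|C| * h ^+ 2 * mass T) = m * h * h by rewrite /m; ring.
    apply: ler_wpM2r; first exact: ltW.
    have m1 : 0 < 2 * (m + 1) by rewrite mulr_gt0// ltr_wpDl.
    have mh0 := mulr_ge0 m0 (ltW h0).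
    by move: hr; rewrite ltr_pdivlMr//; lra.
  by lra.
- move=> t tt r r0; have t0 : 0 <= t by lra.
  have tT : t < T by lra.
  have [M M0 eM] : exists2 M, 0 <= M & forall s, s \in `[0, T] -> e s <= M.
    have [x xT xM] := EVT_max T0 ce.
    by exists (e x); [exact: e0|].
  have cM0 : 0 <= c * M by rewrite mulr_ge0.
  have r20 : 0 < r / 2 by rewrite divr_gt0.
  have tin : t \in `[0, T] by rewrite in_itv/=; lra.
  have [d1 d10 hd1] : exists2 d, 0 < d & forall s, t < s < t + d -> s <= T ->
      A s <= A t + r / 2.
    have tin' : `[0, T]%classic t by move: tin.
    move/subspace_continuousP : (cA) => /(_ t tin') /cvgrPdist_lt /(_ _ r20).
    rewrite near_withinE => /nbhs_ballP[d /= d0 hd]; exists d => // s st sT.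
    have := hd s; rewrite /ball/= ltr_distlC => /(_ _ _) h.
    have : `|A t - A s| < r / 2 by apply: h; rewrite ?in_itv/=; lra.
    by rewrite ltr_distlC => /andP[]; lra.
  have rM : 0 < r / (2 * (c * M + 1)) by rewrite divr_gt0// mulr_gt0//; lra.
  have [d2 d20 hd2] : exists2 d, 0 < d & forall h, 0 < h < d -> mass h <= r / (2 * (c * M + 1)).
    have /cvgrPdist_lt /(_ _ rM) := mass_cvg0 T_gt0.
    move=> /nbhs_ballP[d /= d0 hd]; exists d => // h h0d.
    have := hd h; rewrite /ball/= !sub0r !normrN gtr0_norm; last by lra.
    by move=> /(_ _)/ltW/ler_normlW; apply; lra.
  exists (Num.min d1 d2); first by rewrite lt_min d10.
  move=> s /andP[ts]; rewrite -ltrBlDl lt_min => /andP[sd1 sd2] st1.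
  have sT : s <= T by lra.
  have hA : A s <= A t + r / 2 by apply: hd1 => //; rewrite ts -ltrBlDl.
  have hm : mass (s - t) <= r / (2 * (c * M + 1)).
    by apply: hd2; rewrite subr_gt0 ts.
  have step : memory e s <= memory e t + M * mass (s - t).
    apply: memory_step => //; first exact: continuous_admissible.
      move=> x; rewrite in_itv/= => /andP[x0 xs]; apply: e0.
      by rewrite in_itv/= (ltW x0) (le_trans (ltW xs)).
    move=> x; rewrite in_itv/= => /andP[tx xs]; apply: eM.
    by rewrite in_itv/= (le_trans t0 (ltW tx)) (le_trans (ltW xs)).
  have step' : c * memory e s <= c * (memory e t + M * mass (s - t)) by rewrite ler_wpM2l.
  have : c * M * mass (s - t) <= r / 2.
    apply: (@le_trans _ _ ((c * M + 1) * (r / (2 * (c * M + 1))))).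
      apply: ler_pM => //; first by rewrite mass_ge0//; lra.
      by lra.
    by rewrite le_eqVlt; apply/orP; left; apply/eqP; field; rewrite gt_eqF//; lra.
  move: step' hA; move: (memory e s) (memory e t) (A s) (A t) => F1 F0 A1 A0; lra.
Qed.

End Convolution.

(** * Square-integrable fields *)

Section L2Fields.
Variables (R : realType) (Omega : set (space3 R)).
Local Notation L2 := (L2field Omega).
Local Notation "'[ u , v ]" := (L2dot Omega u v) (at level 0).
Implicit Types (u v w : vfield R) (a b : R).

Let lambda3 : {measure set (space3 R) -> \bar R} := @lebesgue3 R.

Lemma L2field_lin a b u v : L2 u -> L2 v -> L2 (fun x => a *: u x + b *: v x).
Proof.
move=> hu hv i.
have e1 : (1 <= 2%:E :> \bar R)%E by rewrite lee_fin ler1n.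
have [h0 hlin] := Lfun_submod_closed lambda3 e1.
rewrite [X in X \in _](_ : _ = b *: ((fun x => v x 0 i) \_ Omega)
    + (a *: ((fun x => u x 0 i) \_ Omega) + 0)).
  exact: hlin b _ _ (hv i) (hlin a _ _ (hu i) h0).
apply/funext => x.
rewrite -[RHS]/(b * _ + (a * _ + 0)) /patch.
by case: ifP => _; rewrite ?mulr0 ?addr0// !mxE addrC.
Qed.

(** Extended by zero, because measurability is only known for extended fields. *)
Let dotr u v : space3 R -> R := (fun x => dot (u x) (v x)) \_ Omega.

Let integrable_dotr u v : L2 u -> L2 v -> lambda3.-integrable setT (EFin \o dotr u v).
Proof.
move=> hu hv.
have h i : lambda3.-integrable setT (EFin \o (((fun x => u x 0 i) \_ Omega) \* ((fun x => v x 0 i) \_ Omega))%R).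
  by apply/Lfun1_integrable; exact: (Lfun2_mul_Lfun1 (hu i) (hv i)).
have : lambda3.-integrable setT (fun x => \sum_(i < 3)
    (EFin \o (((fun x => u x 0 i) \_ Omega) \* ((fun x => v x 0 i) \_ Omega))%R) x)%E.
  exact: integrable_sum.
apply: eq_integrable => // x _ /=; rewrite sumEFin; congr EFin.
rewrite /dotr /patch; case: ifP => _//.
by rewrite big1// => i _; rewrite mulr0.
Qed.

Let L2dotE u v : '[u, v] = \int[lambda3]_x dotr u v x.
Proof. by rewrite /L2dot Rintegral_mkcond. Qed.

Lemma L2dotC u v : '[u, v] = '[v, u].
Proof.
rewrite /L2dot; apply: eq_Rintegral => x _; apply: eq_bigr => i _.
by rewrite mulrC.
Qed.

Lemma L2dot_linl a b u v w : L2 u -> L2 v -> L2 w ->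
  '[fun x => a *: u x + b *: v x, w] = a * '[u, w] + b * '[v, w].
Proof.
move=> hu hv hw; rewrite !L2dotE.
have iu := integrable_dotr hu hw; have iv := integrable_dotr hv hw.
have mT : measurable [set: space3 R] by [].
rewrite -RintegralZl// -RintegralZl// -RintegralD//; last 2 first.
- exact: integrableZl mT _ _ iu.
- exact: integrableZl mT _ _ iv.
apply: eq_Rintegral => x _; rewrite /dotr /patch; case: ifP => _; last by rewrite !mulr0 addr0.
rewrite /dot !mulr_sumr -big_split/=; apply: eq_bigr => i _.
by rewrite !mxE mulrDl !mulrA.
Qed.

Lemma L2dot_ge0 u : 0 <= '[u, u].
Proof.
by apply: Rintegral_ge0 => x _; apply: sumr_ge0 => i _; rewrite -expr2 sqr_ge0.
Qed.

Lemma L2norm_sqr u : L2norm Omega u ^+ 2 = '[u, u].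
Proof. by rewrite /L2norm sqr_sqrtr// L2dot_ge0. Qed.

Lemma L2norm_ge0 u : 0 <= L2norm Omega u.
Proof. exact: sqrtr_ge0. Qed.

Lemma L2dot_sqr_lin a b u v : L2 u -> L2 v ->
  '[fun x => a *: u x + b *: v x, fun x => a *: u x + b *: v x]
  = a ^+ 2 * '[u, u] + 2 * (a * b) * '[u, v] + b ^+ 2 * '[v, v].
Proof.
move=> hu hv; have hw := L2field_lin a b hu hv.
rewrite L2dot_linl// (L2dotC u) (L2dotC v) !L2dot_linl// (L2dotC v u).
by ring.
Qed.

(** Only a seminorm is available, hence the separate case of a field of norm 0. *)
Lemma L2_cauchy_schwarz u v : L2 u -> L2 v ->
  `|'[u, v]| <= L2norm Omega u * L2norm Omega v.
Proof.
move=> hu hv.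
have h a b := L2dot_ge0 (fun x => a *: u x + b *: v x).
have {}h a b : 0 <= a ^+ 2 * '[u, u] + 2 * (a * b) * '[u, v] + b ^+ 2 * '[v, v].
  by rewrite -L2dot_sqr_lin//; exact: h.
rewrite -(@ler_pXn2r _ 2)// ?nnegrE ?mulr_ge0 ?L2norm_ge0//.
rewrite real_normK ?num_real// exprMn !L2norm_sqr.
move: h (L2dot_ge0 u) (L2dot_ge0 v).
move: '[u, u] '[v, v] '[u, v] => p q r h p0 q0.
have [q00|q_neq0] := eqVneq q 0.
  have [->|r0] := eqVneq r 0; first by rewrite expr2 mul0r q00 mulr0.
  have := h 1 (- (p + 1) / (2 * r)).
  rewrite q00 mulr0 addr0 expr1n mul1r mul1r.
  rewrite (_ : 2 * _ * r = - (p + 1)); last by field.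
  by lra.
have := h q (- r).
rewrite (_ : _ + _ + _ = q * (p * q - r ^+ 2)); last ring.
by rewrite pmulr_rge0 ?subr_ge0// lt_neqAle eq_sym q_neq0.
Qed.

End L2Fields.

(** * Time dependence in the space of square-integrable fields *)

Section L2Evolution.
Variables (R : realType) (Omega : set (space3 R)) (T : R).
Local Notation L2 := (L2field Omega).
Local Notation "'[ u , v ]" := (L2dot Omega u v) (at level 0).
Local Notation nrm := (L2norm Omega).
Variable u : R -> vfield R.
Implicit Types (t s h r : R) (phi du : vfield R).

Let subE (v w : vfield R) : (fun x => v x - w x) = (fun x => 1 *: v x + (-1) *: w x).
Proof. by apply/funext => x; rewrite scale1r scaleN1r. Qed.

Lemma L2norm_sub_sqr (v w : vfield R) : L2 v -> L2 w ->
  nrm (fun x => v x - w x) ^+ 2 = '[v, v] - 2 * '[v, w] + '[w, w].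
Proof. by move=> hv hw; rewrite L2norm_sqr subE L2dot_sqr_lin//; ring. Qed.

Lemma L2dot_subl (v w phi : vfield R) : L2 v -> L2 w -> L2 phi ->
  '[fun x => v x - w x, phi] = '[v, phi] - '[w, phi].
Proof. by move=> hv hw hp; rewrite subE L2dot_linl//; ring. Qed.

Lemma L2field_sub (v w : vfield R) : L2 v -> L2 w -> L2 (fun x => v x - w x).
Proof. by move=> hv hw; rewrite subE; exact: L2field_lin. Qed.

Lemma L2continuous_dot phi : L2continuous Omega T u -> L2 phi ->
  {within `[0, T], continuous (fun s => '[u s, phi])}.
Proof.
move=> [uL2 cu] hphi; apply/subspace_continuousP => t tT.
have tT' : t \in `[0, T] by [].
apply/cvgrPdist_le => e e0; have := cu t tT'.
have e1 : 0 < e / (nrm phi + 1) by rewrite divr_gt0// ltr_wpDl// L2norm_ge0.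
move=> /cvgrPdist_le /(_ _ e1); rewrite !near_withinE.
apply: filterS => s hs sT; have sT' : s \in `[0, T] by [].
have := hs sT; rewrite sub0r normrN ger0_norm ?L2norm_ge0// => {}hs.
rewrite distrC -L2dot_subl//; [|exact: uL2|exact: uL2].
apply: (le_trans (L2_cauchy_schwarz _ _)) => //; first by apply: L2field_sub; exact: uL2.
apply: (@le_trans _ _ (e / (nrm phi + 1) * (nrm phi + 1))).
  by rewrite ler_pM ?L2norm_ge0// lerDl.
by rewrite divfK// gt_eqF// ltr_wpDl// L2norm_ge0.
Qed.

(** The polarization identity reduces the square to products with u t fixed. *)
Lemma L2continuous_sqr : L2continuous Omega T u ->
  {within `[0, T], continuous (fun s => '[u s, u s])}.
Proof.
move=> hu; have [uL2 cu] := hu; apply/subspace_continuousP => t tT.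
have tT' : t \in `[0, T] by [].
have ct := (L2continuous_dot hu (uL2 t tT')).
move/subspace_continuousP : ct => /(_ t tT) ct.
have nt := cu t tT'.
have lim : (nrm (fun x => u s x - u t x) ^+ 2 + (2 * '[u s, u t] - '[u t, u t]))
    @[s --> within `[0, T] (nbhs t)] --> (0 * 0 + (2 * '[u t, u t] - '[u t, u t])).
  apply: cvgD; first by apply: cvgM.
  by apply: cvgB; [apply: cvgM => //; exact: cvg_cst|exact: cvg_cst].
have limE : 0 * 0 + (2 * '[u t, u t] - '[u t, u t]) = '[u t, u t] by ring.
rewrite limE in lim.
apply: cvg_trans lim; apply: near_eq_cvg; rewrite near_withinE; apply: nearW => s sT.
have sT' : s \in `[0, T] by [].
rewrite L2norm_sub_sqr; [|exact: uL2|exact: uL2].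
by rewrite /from_subspace; ring.
Qed.

Lemma L2derivative_quotient t du : L2derivative Omega T u t du ->
  forall e : R, 0 < e -> exists2 d : R, 0 < d & forall s : R, s \in `[0, T] -> t - d < s < t ->
    nrm (fun x => (s - t)^-1 *: (u s x - u t x) - du x) <= e.
Proof.
move=> [_ hd] e e0; move/cvgrPdist_le : hd => /(_ _ e0).
rewrite near_withinE /dnbhs near_withinE => /nbhs_ballP[d /= d0 hd].
exists d => // s sT /andP[ds st]; have := hd s.
rewrite sub0r normrN ger0_norm ?L2norm_ge0//; apply => //.
- by rewrite /ball/= gtr0_norm ?subr_gt0//; lra.
- by rewrite lt_eqF.
Qed.

Hypothesis uL2 : forall s : R, s \in `[0, T] -> L2 (u s).

Lemma L2derivative_dot t du phi : t \in `]0, T] -> L2derivative Omega T u t du -> L2 phi ->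
  forall r : R, 0 < r -> exists2 d : R, 0 < d & forall h : R, 0 < h < d -> 0 <= t - h ->
    '[u t, phi] - '[u (t - h), phi] <= h * '[du, phi] + r * h.
Proof.
move=> tT der hphi r r0; have hdu := der.1.
have e1 : 0 < r / (nrm phi + 1) by rewrite divr_gt0// ltr_wpDl// L2norm_ge0.
have [d d0 hd] := L2derivative_quotient der e1.
exists d => // h /andP[h0 hd'] th.
have tT' : t \in `[0, T] by move: tT; rewrite !in_itv/=; lra.
have sT : t - h \in `[0, T] by move: tT; rewrite !in_itv/=; lra.
have st : t - d < t - h < t by lra.
have := hd _ sT st; set q := (fun x => _ - du x) => nq.
have qE : q = (fun x => (t - h - t)^-1 *: (u (t - h) x - u t x) + (-1) *: du x).
  by apply/funext => x; rewrite /q scaleN1r.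
have hus := uL2 sT; have hut := uL2 tT'.
have hq : L2 q by rewrite qE; apply: L2field_lin => //; exact: L2field_sub.
have qphi : '[q, phi] = (t - h - t)^-1 * ('[u (t - h), phi] - '[u t, phi]) + (-1) * '[du, phi].
  by rewrite qE L2dot_linl//; [rewrite L2dot_subl|exact: L2field_sub].
have : `|'[q, phi]| <= r.
  apply: (le_trans (L2_cauchy_schwarz hq hphi)).
  apply: (@le_trans _ _ (r / (nrm phi + 1) * (nrm phi + 1))).
    by rewrite ler_pM ?L2norm_ge0// lerDl.
  by rewrite divfK// gt_eqF// ltr_wpDl// L2norm_ge0.
rewrite ler_norml => /andP[_]; rewrite qphi.
move: '[u (t - h), phi] '[u t, phi] '[du, phi] => x y z hle.
have := ler_wpM2r (ltW h0) hle.
have -> : t - h - t = - h by ring.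
rewrite (_ : ((- h)^-1 * (x - y) + -1 * z) * h = y - x - h * z); first by lra.
by field; rewrite gt_eqF.
Qed.

(** Differentiability at t gives a Lipschitz bound at t, since the difference
quotients eventually lie within distance 1 of the derivative. *)
Lemma L2derivative_lipschitz t du : t \in `]0, T] -> L2derivative Omega T u t du ->
  exists C : R, exists2 d : R, 0 < d & forall s : R, s \in `[0, T] -> t - d < s < t ->
    '[u s, u s] - 2 * '[u s, u t] + '[u t, u t] <= C * (t - s) ^+ 2.
Proof.
move=> tT der; have hdu := der.1.
have [d d0 hd] := L2derivative_quotient der ltr01.
exists ((1 + nrm du) ^+ 2); exists d => // s sT st.
have tT' : t \in `[0, T] by move: tT; rewrite !in_itv/=; lra.
have := hd _ sT st; set q := (fun x => _ - du x) => nq.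
have qE : q = (fun x => (s - t)^-1 *: (u s x - u t x) + (-1) *: du x).
  by apply/funext => x; rewrite /q scaleN1r.
have hus := uL2 sT; have hut := uL2 tT'.
have hq : L2 q by rewrite qE; apply: L2field_lin => //; exact: L2field_sub.
rewrite -L2norm_sub_sqr//.
have -> : (fun x => u s x - u t x) = (fun x => (s - t) *: q x + (s - t) *: du x).
  apply/funext => x; rewrite -scalerDr /q subrK scalerA mulfV ?scale1r//.
  by rewrite subr_eq0 lt_eqF//; case/andP: st.
rewrite L2norm_sqr L2dot_sqr_lin//.
have := le_trans (ler_norm _) (L2_cauchy_schwarz hq hdu).
rewrite -!L2norm_sqr; have := L2norm_ge0 Omega q; have := L2norm_ge0 Omega du.
move: (nrm q) (nrm du) '[q, du] nq => x y z x1 y0 x0 zxy.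
have zy : z <= y by apply: (le_trans zxy); rewrite ler_piMl.
have xx : x ^+ 2 <= 1 by rewrite expr_le1.
rewrite (_ : _ + _ + _ = (x ^+ 2 + 2 * z + y ^+ 2) * (t - s) ^+ 2); last by ring.
by rewrite ler_wpM2r ?sqr_ge0//; lra.
Qed.

End L2Evolution.

(** * Dissipation of the energy *)

Theorem theorem3p3 (R : realType) (Omega : set (space3 R))
    (T eps_s eps_inf alpha beta : R) (E0 H0 : vfield R)
    (E H P : R -> vfield R) :
  spatial_domain Omega ->
  0 < T ->
  0 < alpha <= 1 -> 0 < beta <= 1 ->
  1 <= eps_inf -> eps_inf < eps_s ->
  L2field Omega E0 -> L2field Omega H0 ->
  HN_solution Omega T eps_s eps_inf alpha beta E0 H0 E H P ->
  forall t1 t2 : R, t1 \in `[0, T] -> t2 \in `[0, T] -> t2 < t1 ->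
    HN_energy Omega eps_s eps_inf alpha beta E H t1 <=
    HN_energy Omega eps_s eps_inf alpha beta E H t2.
Proof.
move=> _ T0 alpha01 /andP[beta0 beta1] eps1 eps_lt _ _.
case=> [[cE cH cP] _ H0curlE maxwell polarization] t1 t2 t1T t2T t21.
pose k := hn_kernel alpha beta.
pose c := eps_s - eps_inf.
have c0 : 0 <= c by rewrite subr_ge0 ltW.
have eps0 : 0 <= eps_inf by exact: le_trans eps1.
pose e s := L2dot Omega (E s) (E s).
pose A s := eps_inf * e s + L2dot Omega (H s) (H s).
pose a t s := L2dot Omega (E s) (E t).
pose B t s := eps_inf * a t s + L2dot Omega (H s) (H t).
have energyE t : HN_energy Omega eps_s eps_inf alpha beta E H t = A t + c * memory k e t.
  rewrite /HN_energy !L2norm_sqr; congr (_ + _ * _).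
  by apply: eq_Rintegral => s _; rewrite L2norm_sqr.
have [EL2 _] := cE; have [HL2 _] := cH; have [PL2 _] := cP.
have ocT t : t \in `]0, T] -> t \in `[0, T] by rewrite !in_itv/= => /andP[/ltW -> ->].
have EL2' t : t \in `]0, T] -> L2field Omega (E t) by move=> /ocT; exact: EL2.
have HL2' t : t \in `]0, T] -> L2field Omega (H t) by move=> /ocT; exact: HL2.
have memoryP t s : t \in `]0, T] -> s \in `]0, T] -> c * memory k (a t) s = L2dot Omega (P s) (E t).
  move=> tT sT; apply/esym/eqP; rewrite -subr_eq0; apply/eqP.
  exact: polarization sT _ (EL2' _ tT).
have k_ge0 (t : R) : 0 < t -> 0 <= k t by exact: hn_kernel_ge0.
have k_nincr (s t : R) : 0 < s -> s <= t -> k t <= k s by exact: hn_kernel_nincr.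
have k_int : (@lebesgue_measure R).-integrable `[0, T] (EFin \o k).
  exact: integrable_hn_kernel.
(* From here on, the kernel is any function with these three properties. *)
rewrite !energyE; clear energyE polarization; clearbody k c.
apply: (@memory_energy_nonincreasing _ k T _ _ _ A e a B c) => //; last exact: ltW.
- move=> s; apply: cvgD; last exact: L2continuous_sqr.
  by apply: cvgM; [exact: cvg_cst|exact: L2continuous_sqr].
- exact: L2continuous_sqr.
- by move=> t _; exact: L2dot_ge0.
- by move=> t tT; apply: L2continuous_dot => //; exact: EL2'.
- move=> t s tT sT; rewrite /e /a -L2norm_sub_sqr ?sqr_ge0//; [exact: EL2|exact: EL2'].
- move=> t tT; have [dE [_ [_ [_ [[derE _ _] _ _ _]]]]] := maxwell t tT.
  have [C [d d0 hd]] := L2derivative_lipschitz EL2 tT derE.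
  exists C; exists d; first exact: d0.
  by move=> s sT st; exact: hd.
- move=> t s tT sT; have sqE := L2norm_sub_sqr (EL2 s sT) (EL2' t tT).
  have sqH := L2norm_sub_sqr (HL2 s sT) (HL2' t tT).
  have nE := sqr_ge0 (L2norm Omega (fun x => E s x - E t x)).
  have nH := sqr_ge0 (L2norm Omega (fun x => H s x - H t x)).
  rewrite sqE in nE; rewrite sqH in nH.
  have {}nE := mulr_ge0 eps0 nE.
  rewrite -subr_ge0 (_ : _ - _ = eps_inf * (L2dot Omega (E s) (E s) - 2 * L2dot Omega (E s) (E t)
     + L2dot Omega (E t) (E t)) + (L2dot Omega (H s) (H s) - 2 * L2dot Omega (H s) (H t)
     + L2dot Omega (H t) (H t))); first exact: addr_ge0.
  by rewrite /B /A /e /a; ring.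
move=> t tT r r0; have Et := EL2' t tT; have Ht := HL2' t tT.
have [dE [dH [dP [curlE [[derE derH derP] wcE ampere faraday]]]]] := maxwell t tT.
(* The curl terms cancel. *)
have balance : eps_inf * L2dot Omega dE (E t) + L2dot Omega dH (H t) + L2dot Omega dP (E t) = 0.
  have h1 := ampere _ _ (H0curlE t tT) wcE; have h2 := faraday _ Ht.
  by rewrite (L2dotC _ curlE) in h2; lra.
(* The three difference quotients enter with total weight eps_inf + 2. *)
pose r' := r / (eps_inf + 2).
have r'0 : 0 < r' by rewrite divr_gt0//; lra.
have [d1 d10 h1] := L2derivative_dot EL2 tT derE Et r'0.
have [d2 d20 h2] := L2derivative_dot HL2 tT derH Ht r'0.
have [d3 d30 h3] := L2derivative_dot PL2 tT derP Et r'0.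
exists (Num.min d1 (Num.min d2 d3)); first by rewrite !lt_min d10 d20.
move=> h; rewrite !lt_min => /and4P[h0 hd1 hd2 hd3] th.
have thT : t - h \in `]0, T] by move: tT; rewrite !in_itv/=; lra.
rewrite (memoryP _ _ tT tT) (memoryP _ _ tT thT).
have {}h1 := h1 h; rewrite h0 hd1 (ltW th) in h1; have {}h1 := h1 isT isT.
have {}h2 := h2 h; rewrite h0 hd2 (ltW th) in h2; have {}h2 := h2 isT isT.
have {}h3 := h3 h; rewrite h0 hd3 (ltW th) in h3; have {}h3 := h3 isT isT.
have {}h1 := ler_wpM2l eps0 h1.
have rE : (eps_inf + 2) * r' = r by rewrite /r' mulrC divfK// gt_eqF//; lra.
have hbal : h * (eps_inf * L2dot Omega dE (E t) + L2dot Omega dH (H t) + L2dot Omega dP (E t)) = 0.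
  by rewrite balance mulr0.
rewrite -rE /B /a.
move: h1 h2 h3 hbal.
move: (L2dot _ (E t) (E t)) (L2dot _ (E (t - h)) (E t)) (L2dot _ dE (E t)).
move: (L2dot _ (H t) (H t)) (L2dot _ (H (t - h)) (H t)) (L2dot _ dH (H t)).
move: (L2dot _ (P t) (E t)) (L2dot _ (P (t - h)) (E t)) (L2dot _ dP (E t)).
move=> p1 p0 dp m1 m0 dm e1 e0 de; lra.
Qed.
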